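(* Fix an integer $n\geq 2$, let $\Gamma$ be a nontrivial finite group, and let $H=\mathbb{C}\Gamma$ be its complex group Hopf algebra. Then the iterated equivariant join $E_nH$ is cleft over $H$ if and only if $\Gamma$ is perfect.
   Context: $H=\mathbb{C}\Gamma$ is a Hopf algebra with $\Delta(\gamma)=\gamma\otimes\gamma$ and counit $\varepsilon(\gamma)=1$ for $\gamma\in\Gamma$; it is also a finite-dimensional $C^*$-algebra, and $(H,\Delta)$ is a compact quantum group. A group is perfect if it equals its commutator subgroup. If $(H,\Delta)$ coacts on a unital $C^*$-algebra $A$ by $\delta:A\to A\otimes H$, the equivariant join is $A \circledast^{\delta} H := \{f\in C([0,1],A\otimes H): f(0)\in\delta(A),\ f(1)\in\mathbb{C}\otimes H\}$, with induced coaction $(\delta_\Delta f)(t) = (\mathrm{id}_A\otimes\Delta)(f(t))$. The iterated joins are $(E_0H,\Delta_0) := (H,\Delta)$ and $(E_nH,\Delta_n) := (E_{n-1}H\circledast^{\Delta_{n-1}}H, (\Delta_{n-1})_\Delta)$. $E_nH$ is regarded as an $H$-comodule algebra via $\Delta_n$. An $H$-comodule algebra $A$ is cleft (over $H$) if there exists a linear $H$-comodule map $\phi:H\to A$ (a cleaving map) that is invertible for the convolution product $\phi*\psi=\mathrm{mult}\circ(\phi\otimes\psi)\circ\Delta$, whose identity is $h\mapsto\varepsilon(h)1_A$. The map $\phi$ is not required to be multiplicative or to respect adjoints. *)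

(* Defs.v *)
From HB Require Import structures.
From mathcomp Require Import all_boot all_order all_algebra all_fingroup.
From mathcomp Require Import complex.
From mathcomp Require Import all_classical reals topology normedtype derive.

Set Implicit Arguments.
Unset Strict Implicit.
Unset Printing Implicit Defensive.

Import Order.TTheory GRing.Theory Num.Theory.
Import numFieldNormedType.Exports.
Import ComplexField.Normc.

Local Open Scope classical_set_scope.
Local Open Scope ring_scope.
Local Open Scope complex_scope.

(* Unital normed complex algebras; only the topology defined by the norm is
   used below. *)
HB.mixin Record Algebra_hasNorm (R : realType) A of GRing.Algebra R[i] A := {
  anorm : A -> R;
  anorm_eq0 : forall x, anorm x = 0 -> x = 0;
  anormD : forall x y, anorm (x + y) <= anorm x + anorm y;
  anormZ : forall (k : R[i]) x, anorm (k *: x) = normc k * anorm x;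
  anormM : forall x y, anorm (x * y) <= anorm x * anorm y }.

#[short(type="normedAlgType")]
HB.structure Definition NormedAlgebra (R : realType) :=
  { A of GRing.Algebra R[i] A & Algebra_hasNorm R A }.

Section NormedAlgebraTheory.
Variables (R : realType) (A : normedAlgType R).
Implicit Types x y : A.

Lemma anorm0 : anorm (0 : A) = 0.
Proof. by rewrite -(scale0r (0 : A)) anormZ normc0 mul0r. Qed.

Lemma anormN x : anorm (- x) = anorm x.
Proof. by rewrite -scaleN1r anormZ normcN normc1 mul1r. Qed.

Lemma anorm_ge0 x : 0 <= anorm x.
Proof.
have := anormD x (- x); rewrite subrr anorm0 anormN -mulr2n.
by rewrite pmulrn_lge0.
Qed.

Lemma anorm_dist x y : `|anorm x - anorm y| <= anorm (x - y).
Proof.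
have H u v : anorm u <= anorm v + anorm (u - v).
  by rewrite (le_trans _ (anormD _ _)) // addrC subrK.
rewrite ler_norml lerBlDl H andbT lerNl opprB lerBlDl -(anormN (x - y)) opprB.
exact: H.
Qed.

End NormedAlgebraTheory.

Section ComplexNumbers.
Variable R : realType.

HB.instance Definition _ := GRing.Algebra.on R[i]^o.
HB.instance Definition _ := Algebra_hasNorm.Build R R[i]^o
  (@eq0_normc R) (@le_normcD R) (@normcM R)
  (fun x y => eq_ind_r (fun z => z <= normc x * normc y) (lexx _) (normcM x y)).

End ComplexNumbers.

(* [tensH A G] is the tensor product of A with the group algebra CG: the
   element \sum_g a_g (x) g is encoded by the family g |-> a_g.  As CG is
   finite dimensional, the algebraic tensor product is already complete, and
   the topology of its C*-norm is the product topology of A^G.  The norm chosen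
   below is the submultiplicative one \sum_g |a_g|, which is equivalent to the
   C*-norm and hence yields the same continuous functions. *)
Record tensH (A : Type) (G : finGroupType) :=
  TensH { coef :> {ffun G -> A} }.

Notation "\tens_ g E" := (TensH [ffun g => E])
  (at level 36, g at level 0, E at level 36, format "\tens_ g  E") : ring_scope.

HB.instance Definition _ (A : Type) (G : finGroupType) :=
  [isNew for @coef A G].
HB.instance Definition _ (A : choiceType) (G : finGroupType) :=
  [Choice of tensH A G by <:].

Lemma tensE (A : Type) (G : finGroupType) (F : G -> A) g : (\tens_h F h) g = F g.
Proof. exact: ffunE. Qed.

Lemma tensP (A : Type) (G : finGroupType) (x y : tensH A G) : x =1 y <-> x = y.
Proof.
split=> [xy|->//]; case: x y xy => [x] [y] /= xy.
by congr TensH; apply/ffunP.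
Qed.

Section TensH.
Variables (R : realType) (G : finGroupType) (A : normedAlgType R).
Implicit Types x y z : tensH A G.

Let tadd x y : tensH A G := \tens_g (x g + y g).
Let topp x : tensH A G := \tens_g (- x g).
Let tscale (k : R[i]) x : tensH A G := \tens_g (k *: x g).

Fact taddA : associative tadd.
Proof. by move=> x y z; apply/tensP => g; rewrite !tensE addrA. Qed.

Fact taddC : commutative tadd.
Proof. by move=> x y; apply/tensP => g; rewrite !tensE addrC. Qed.

Fact tadd0 : left_id (\tens_g 0) tadd.
Proof. by move=> x; apply/tensP => g; rewrite !tensE add0r. Qed.

Fact taddN : left_inverse (\tens_g 0) topp tadd.
Proof. by move=> x; apply/tensP => g; rewrite !tensE addNr. Qed.

HB.instance Definition _ :=
  GRing.isZmodule.Build (tensH A G) taddA taddC tadd0 taddN.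

Lemma tensDE x y g : (x + y) g = x g + y g.
Proof. exact: tensE. Qed.

Lemma tensNE x g : (- x) g = - x g.
Proof. exact: tensE. Qed.

Lemma tens0E g : (0 : tensH A G) g = 0.
Proof. exact: tensE. Qed.

Lemma tens_sumE (I : Type) (r : seq I) (P : pred I) (F : I -> tensH A G) g :
  (\sum_(i <- r | P i) F i) g = \sum_(i <- r | P i) F i g.
Proof.
by apply: (big_morph (fun x => coef x g)) => [x y|]; rewrite (tensDE, tens0E).
Qed.

Fact tscaleA (k l : R[i]) x : tscale k (tscale l x) = tscale (k * l) x.
Proof. by apply/tensP => g; rewrite !tensE scalerA. Qed.

Fact tscale1 : left_id 1 tscale.
Proof. by move=> x; apply/tensP => g; rewrite !tensE scale1r. Qed.

Fact tscaleDr : right_distributive tscale +%R.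
Proof. by move=> k x y; apply/tensP => g; rewrite !tensE scalerDr. Qed.

Fact tscaleDl x : {morph tscale^~ x : k l / k + l}.
Proof. by move=> k l; apply/tensP => g; rewrite !tensE scalerDl. Qed.

HB.instance Definition _ :=
  GRing.Zmodule_isLmodule.Build R[i] (tensH A G)
    tscaleA tscale1 tscaleDr tscaleDl.

Lemma tensZE (k : R[i]) x g : (k *: x) g = k *: x g.
Proof. exact: tensE. Qed.

(* a (x) g *)
Definition pureT (a : A) (g : G) : tensH A G :=
  \tens_h (if h == g then a else 0).

(* (a (x) h)(b (x) k) = ab (x) hk, extended bilinearly. *)
Let tmul x y : tensH A G := \tens_g (\sum_h x h * y (h^-1 * g)%g).

Fact tmulA : associative tmul.
Proof.
move=> x y z; apply/tensP => g; rewrite !tensE.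
under eq_bigr do rewrite tensE mulr_sumr.
under [RHS]eq_bigr do rewrite tensE mulr_suml.
rewrite [RHS]exchange_big /=; apply: eq_bigr => h _.
rewrite [RHS](reindex_inj (mulgI h)) /=; apply: eq_bigr => k _.
by rewrite mulKg mulrA invMg mulgA.
Qed.

Fact tmul1 : left_id (pureT 1 1%g) tmul.
Proof.
move=> x; apply/tensP => g; rewrite tensE (bigD1 1%g) //= big1 => [|h].
  by rewrite tensE eqxx mul1r invg1 mul1g addr0.
by rewrite tensE => /negbTE->; rewrite mul0r.
Qed.

Fact tmulr1 : right_id (pureT 1 1%g) tmul.
Proof.
move=> x; apply/tensP => g; rewrite tensE (bigD1 g) //= big1 => [|h hg].
  by rewrite tensE mulVg eqxx mulr1 addr0.
by rewrite tensE -eq_mulVg1 (negbTE hg) mulr0.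
Qed.

Fact tmulDl : left_distributive tmul +%R.
Proof.
move=> x y z; apply/tensP => g; rewrite !tensE -big_split /=.
by apply: eq_bigr => h _; rewrite tensE mulrDl.
Qed.

Fact tmulDr : right_distributive tmul +%R.
Proof.
move=> x y z; apply/tensP => g; rewrite !tensE -big_split /=.
by apply: eq_bigr => h _; rewrite tensE mulrDr.
Qed.

Fact tone_neq0 : pureT 1 1%g != 0.
Proof.
apply/eqP => /tensP /(_ 1%g); rewrite tensE tens0E eqxx.
by apply/eqP; exact: oner_neq0.
Qed.

HB.instance Definition _ :=
  GRing.Zmodule_isNzRing.Build (tensH A G)
    tmulA tmul1 tmulr1 tmulDl tmulDr tone_neq0.

Lemma tensME x y g : (x * y) g = \sum_h x h * y (h^-1 * g)%g.
Proof. exact: tensE. Qed.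

Fact tscaleAl (k : R[i]) x y : k *: (x * y) = (k *: x) * y.
Proof.
apply/tensP => g; rewrite tensZE !tensME scaler_sumr.
by apply: eq_bigr => h _; rewrite tensZE scalerAl.
Qed.

Fact tscaleAr (k : R[i]) x y : k *: (x * y) = x * (k *: y).
Proof.
apply/tensP => g; rewrite tensZE !tensME scaler_sumr.
by apply: eq_bigr => h _; rewrite tensZE scalerAr.
Qed.

HB.instance Definition _ :=
  GRing.LSemiModule_isLSemiAlgebra.Build R[i] (tensH A G) tscaleAl.
HB.instance Definition _ :=
  GRing.LSemiAlgebra_isSemiAlgebra.Build R[i] (tensH A G) tscaleAr.

Definition tnorm x : R := \sum_g anorm (x g).

Fact tnorm_eq0 x : tnorm x = 0 -> x = 0.
Proof.
move=> /eqP; rewrite psumr_eq0 => [/allP x0|g _]; last exact: anorm_ge0.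
apply/tensP => g; rewrite tens0E; apply/anorm_eq0/eqP.
by apply: (implyP (x0 g _)); rewrite ?mem_index_enum.
Qed.

Fact tnormD x y : tnorm (x + y) <= tnorm x + tnorm y.
Proof.
by rewrite /tnorm -big_split; apply: ler_sum => g _; rewrite tensDE anormD.
Qed.

Fact tnormZ (k : R[i]) x : tnorm (k *: x) = normc k * tnorm x.
Proof.
by rewrite /tnorm mulr_sumr; apply: eq_bigr => g _; rewrite tensZE anormZ.
Qed.

Lemma anorm_sum (B : normedAlgType R) (I : finType) (F : I -> B) :
  anorm (\sum_i F i) <= \sum_i anorm (F i).
Proof.
elim/big_ind2: _ => [|u a v b ua vb|//]; first by rewrite anorm0.
exact: le_trans (anormD _ _) (lerD ua vb).
Qed.

Fact tnormM x y : tnorm (x * y) <= tnorm x * tnorm y.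
Proof.
apply: (@le_trans _ _ (\sum_g \sum_h anorm (x h) * anorm (y (h^-1 * g)%g))).
  apply: ler_sum => g _; rewrite tensME (le_trans (anorm_sum _)) //.
  by apply: ler_sum => h _; exact: anormM.
rewrite exchange_big mulr_suml ler_sum //= => h _.
rewrite -mulr_sumr (reindex_inj (mulgI h)) /=.
by under eq_bigr do rewrite mulKg.
Qed.

HB.instance Definition _ :=
  Algebra_hasNorm.Build R (tensH A G) tnorm_eq0 tnormD tnormZ tnormM.

Lemma tensnormE x : anorm x = \sum_g anorm (x g).
Proof. by []. Qed.

Lemma anorm_coef_le x g : anorm (x g) <= anorm x.
Proof.
by rewrite tensnormE (bigD1 g) //= lerDl sumr_ge0 // => h _; exact: anorm_ge0.
Qed.

Lemma pureTD (a b : A) g : pureT (a + b) g = pureT a g + pureT b g.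
Proof.
by apply/tensP => h; rewrite tensDE !tensE; case: ifP; rewrite ?addr0.
Qed.

Lemma pureTZ (k : R[i]) (a : A) g : pureT (k *: a) g = k *: pureT a g.
Proof.
by apply/tensP => h; rewrite tensZE !tensE; case: ifP; rewrite ?scaler0.
Qed.

Lemma pureT_sum (I : finType) (F : I -> A) g :
  pureT (\sum_i F i) g = \sum_i pureT (F i) g.
Proof.
apply: (big_morph (pureT ^~ g)) => [a b|]; first exact: pureTD.
by apply/tensP => h; rewrite tensE tens0E if_same.
Qed.

Lemma pureTM (a b : A) g h : pureT a g * pureT b h = pureT (a * b) (g * h)%g.
Proof.
apply/tensP => k; rewrite tensME (bigD1 g) //= big1 => [|l lg].
  by rewrite !tensE eqxx addr0 (can2_eq (mulKVg g) (mulKg g)); case: ifP; rewrite ?mulr0.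
by rewrite tensE (negbTE lg) mul0r.
Qed.

Lemma anorm_pureT (a : A) g : anorm (pureT a g) = anorm a.
Proof.
rewrite tensnormE (bigD1 g) //= big1 ?addr0 ?tensE ?eqxx // => h hg.
by rewrite tensE (negbTE hg) anorm0.
Qed.

End TensH.

Arguments pureT {R G A}.

Section IdDelta.
Variables (R : realType) (G : finGroupType) (A : normedAlgType R).
Implicit Types x y : tensH A G.

(* id (x) Delta : A (x) CG -> (A (x) CG) (x) CG, where Delta g = g (x) g. *)
Definition idDelta x : tensH (tensH A G) G := \tens_g pureT (x g) g.

Lemma idDelta_linear (k : R[i]) x y :
  idDelta (k *: x + y) = k *: idDelta x + idDelta y.
Proof.
by apply/tensP => g; rewrite tensDE tensZE !tensE pureTD pureTZ.
Qed.

Lemma idDelta1 : idDelta 1 = 1.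
Proof.
apply/tensP => g; rewrite !tensE; case: eqP => [->//|_].
by apply/tensP => h; rewrite tensE tens0E if_same.
Qed.

Lemma idDeltaM x y : idDelta (x * y) = idDelta x * idDelta y.
Proof.
apply/tensP => g; rewrite !tensE pureT_sum; apply: eq_bigr => h _.
by rewrite !tensE pureTM mulKVg.
Qed.

Lemma idDelta_norm x : anorm (idDelta x) = anorm x.
Proof.
by rewrite !tensnormE; apply: eq_bigr => g _; rewrite tensE anorm_pureT.
Qed.

(* (id (x) epsilon) : A (x) CG -> A, where epsilon g = 1. *)
Definition idEps x : A := \sum_g x g.

End IdDelta.

(* F (x) id : A (x) CG -> B (x) CG *)
Definition mapH (A B : Type) (G : finGroupType) (F : A -> B) (x : tensH A G) :
  tensH B G := \tens_g F (x g).

(* Right coactions of (CG, Delta): unital algebra morphisms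
   delta : A -> A (x) CG that are bounded, coassociative and counital. *)
HB.mixin Record NormedAlgebra_hasCoaction (R : realType) (G : finGroupType) A
    of NormedAlgebra R A := {
  coact : A -> tensH A G;
  coact_linear : forall (k : R[i]) (a b : A),
    coact (k *: a + b) = k *: coact a + coact b;
  coact1 : coact 1 = 1;
  coactM : forall a b : A, coact (a * b) = coact a * coact b;
  coact_bounded : exists M, forall a : A, anorm (coact a) <= M * anorm a;
  coactA : forall a : A, mapH coact (coact a) = idDelta (coact a);
  coact_counit : forall a : A, idEps (coact a) = a }.

#[short(type="comodAlgType")]
HB.structure Definition ComoduleAlgebra (R : realType) (G : finGroupType) :=
  { A of NormedAlgebra R A & NormedAlgebra_hasCoaction R G A }.

Section TensCoaction.
Variables (R : realType) (G : finGroupType) (A : normedAlgType R).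

Fact tens_bounded :
  exists M, forall x : tensH A G, anorm (idDelta x) <= M * anorm x.
Proof. by exists 1 => x; rewrite idDelta_norm mul1r. Qed.

Fact tens_coactA (x : tensH A G) :
  mapH (@idDelta R G A) (idDelta x) = idDelta (idDelta x).
Proof.
apply/tensP => g; rewrite !tensE; apply/tensP => h; rewrite !tensE.
case: eqP => [->//|_]; apply/tensP => k.
by rewrite tensE tens0E if_same.
Qed.

Fact tens_counit (x : tensH A G) : idEps (idDelta x) = x.
Proof.
apply/tensP => g; rewrite /idEps tens_sumE (bigD1 g) //= big1.
  by rewrite !tensE eqxx addr0.
by move=> h hg; rewrite !tensE eq_sym (negbTE hg).
Qed.

HB.instance Definition _ :=
  NormedAlgebra_hasCoaction.Build R G (tensH A G)
    (@idDelta_linear R G A) (@idDelta1 R G A) (@idDeltaM R G A) tens_bounded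
    tens_coactA tens_counit.

End TensCoaction.

(* H = CG, as C (x) CG; its coaction is then Delta. *)
Definition groupAlg (R : realType) (G : finGroupType) : comodAlgType R G :=
  tensH R[i]^o G.

Definition unitI (R : realType) : Type :=
  set_type ([set` `[0%R, 1%R]] : set R).
HB.instance Definition _ (R : realType) := Topological.on (unitI R).

(* Unification unfolds [nbhs] on this subtype before looking for the filter
   instance. *)
#[global] Hint Extern 0 (Filter (nbhs_of_open _ _)) =>
  exact: nbhs_filter : typeclass_instances.

Section UnitInterval.
Variable R : realType.

Fact unitI0_subproof : (0 : R) \in [set` `[0%R, 1%R]].
Proof. by rewrite inE /= in_itv /= lexx ler01. Qed.

Fact unitI1_subproof : (1 : R) \in [set` `[0%R, 1%R]].
Proof. by rewrite inE /= in_itv /= lexx ler01. Qed.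

Definition unitI0 : unitI R := exist _ 0 unitI0_subproof.
Definition unitI1 : unitI R := exist _ 1 unitI1_subproof.

Lemma unitI_bounded (f : unitI R -> R) :
  continuous f -> exists M, forall t, f t <= M.
Proof.
move=> /(@subspace_valL_continuousP' R [set` `[0%R, 1%R]] R 0) cf.
have [c _ fc] := EVT_max (@ler01 R) cf.
exists (valL_ 0 f c) => t; have := fc (val t).
have /set_mem /= tI := valP t.
move=> /(_ tI); have /(congr1 (@^~ t)) /= <- // := valLK 0 f.
Qed.

End UnitInterval.

Section NormContinuity.
Variables (R : realType) (A : normedAlgType R).
Implicit Types f g : unitI R -> A.

(* Continuity of f : [0, 1] -> A for the topology of the norm of A. *)
Definition ncontinuous f :=
  forall t, (fun s => anorm (f s - f t)) @ t --> (0 : R).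

Lemma ncontinuous_le f (b : unitI R -> unitI R -> R) :
  (forall t s, anorm (f s - f t) <= b t s) ->
  (forall t, b t @ t --> (0 : R)) -> ncontinuous f.
Proof.
move=> fb b0 t; apply: (@squeeze_cvgr _ (nbhs t) _ _ (cst 0) (b t)).
- by apply: nearW => s; rewrite anorm_ge0 fb.
- exact: cvg_cst.
- exact: b0.
Qed.

Lemma ncontinuous_cst (a : A) : ncontinuous (fun=> a).
Proof. by move=> t; rewrite subrr anorm0; exact: cvg_cst. Qed.

Lemma ncontinuous_norm f : ncontinuous f -> continuous (anorm \o f).
Proof.
move=> cf t; apply/subr_cvg0/norm_cvg0P.
apply: (@squeeze_cvgr _ (nbhs t) _ _ (cst 0) (fun s => anorm (f s - f t))).
- by apply: nearW => s /=; rewrite normr_ge0 anorm_dist.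
- exact: cvg_cst.
- exact: cf.
Qed.

Lemma ncontinuous_bounded f :
  ncontinuous f -> exists M, forall t, anorm (f t) <= M.
Proof. by move=> /ncontinuous_norm; exact: unitI_bounded. Qed.

Lemma ncontinuous_lin f g (k : R[i]) :
  ncontinuous f -> ncontinuous g -> ncontinuous (fun t => k *: f t + g t).
Proof.
move=> cf cg.
apply: (@ncontinuous_le _ (fun t s =>
    normc k * anorm (f s - f t) + anorm (g s - g t))) => [t s|t].
  by rewrite opprD addrACA -scalerBr -anormZ anormD.
rewrite -[0]addr0 -[X in X + _](mulr0 (normc k)).
by apply: cvgD (cg t); apply: cvgMr (cf t); exact: cvg_cst.
Qed.

Lemma ncontinuousM f g :
  ncontinuous f -> ncontinuous g -> ncontinuous (fun t => f t * g t).
Proof.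
move=> cf cg.
apply: (@ncontinuous_le _ (fun t s => anorm (f s - f t) * anorm (g s)
    + anorm (f t) * anorm (g s - g t))) => [t s|t].
  have -> : f s * g s - f t * g t = (f s - f t) * g s + f t * (g s - g t).
    by rewrite mulrBl mulrBr addrA subrK.
  by rewrite (le_trans (anormD _ _)) // lerD // anormM.
rewrite -[0]addr0 -[X in X + _](mul0r (anorm (g t))).
rewrite -[X in _ + X](mulr0 (anorm (f t))).
apply: cvgD; apply: cvgM; [exact: cf|exact: ncontinuous_norm|
  exact: cvg_cst|exact: cg].
Qed.

End NormContinuity.

Section Join.
Variables (R : realType) (G : finGroupType) (A : comodAlgType R G).
Implicit Types f g : unitI R -> tensH A G.

(* 1 (x) h *)
Definition oneT (h : groupAlg R G) : tensH A G := \tens_g (h g *: 1).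

Lemma oneT_linear (k : R[i]) h1 h2 :
  oneT (k *: h1 + h2) = k *: oneT h1 + oneT h2.
Proof.
by apply/tensP => g; rewrite tensDE tensZE !tensE scalerDl scalerA.
Qed.

Lemma oneT1 : oneT 1 = 1.
Proof.
by apply/tensP => g; rewrite !tensE; case: eqP; rewrite ?scale1r ?scale0r.
Qed.

Lemma oneTM h1 h2 : oneT (h1 * h2) = oneT h1 * oneT h2.
Proof.
apply/tensP => g; rewrite tensME !tensE scaler_suml; apply: eq_bigr => h _.
by rewrite !tensE -scalerAl mul1r scalerA.
Qed.

(* Membership in A *^delta H *)
Definition join_cond f : Prop :=
  [/\ ncontinuous f,
      exists a : A, f (unitI0 R) = coact a
    & exists h : groupAlg R G, f (unitI1 R) = oneT h].

Lemma join_cond1 : join_cond (fun=> 1).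
Proof.
split; first exact: ncontinuous_cst.
  by exists 1; rewrite coact1.
by exists 1; rewrite oneT1.
Qed.

Lemma join_cond0 : join_cond (fun=> 0).
Proof.
split; first exact: ncontinuous_cst.
  by exists (- 1 *: 1 + 1); rewrite coact_linear coact1 scaleN1r addNr.
by exists (- 1 *: 1 + 1); rewrite oneT_linear oneT1 scaleN1r addNr.
Qed.

Lemma join_cond_lin f g (k : R[i]) :
  join_cond f -> join_cond g -> join_cond (fun t => k *: f t + g t).
Proof.
move=> [cf [a fa] [h fh]] [cg [b gb] [l gl]]; split.
- exact: ncontinuous_lin.
- by exists (k *: a + b); rewrite coact_linear fa gb.
- by exists (k *: h + l); rewrite oneT_linear fh gl.
Qed.

Lemma join_condM f g :
  join_cond f -> join_cond g -> join_cond (fun t => f t * g t).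
Proof.
move=> [cf [a fa] [h fh]] [cg [b gb] [l gl]]; split.
- exact: ncontinuousM.
- by exists (a * b); rewrite coactM fa gb.
- by exists (h * l); rewrite oneTM fh gl.
Qed.

Record join := Join {
  jfun :> unitI R -> tensH A G;
  joinP : `[< join_cond jfun >] }.

HB.instance Definition _ := [isSub for jfun].
HB.instance Definition _ := [Choice of join by <:].

Lemma join_ext (x y : join) : x =1 y <-> x = y.
Proof. by split=> [xy|->//]; apply/val_inj/funext. Qed.

Implicit Types x y z : join.

Let mk f (jf : join_cond f) : join := Join (asboolT jf).

Let jcond x : join_cond x := asboolW (joinP x).

Let jlin (k : R[i]) x y : join := mk (join_cond_lin k (jcond x) (jcond y)).
Let jzero : join := mk join_cond0.
Let jone : join := mk join_cond1.
Let jadd x y : join := jlin 1 x y.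
Let jscale k x : join := jlin k x jzero.
Let jopp x : join := jscale (- 1) x.
Let jmul x y : join := mk (join_condM (jcond x) (jcond y)).

Let jmulE x y t : jmul x y t = x t * y t. Proof. by []. Qed.
Let jaddE x y t : jadd x y t = x t + y t. Proof. by rewrite /= scale1r. Qed.
Let jscaleE k x t : jscale k x t = k *: x t. Proof. by rewrite /= addr0. Qed.
Let joppE x t : jopp x t = - x t. Proof. by rewrite jscaleE scaleN1r. Qed.

Fact jaddA : associative jadd.
Proof. by move=> x y z; apply/join_ext => t; rewrite !jaddE addrA. Qed.
Fact jaddC : commutative jadd.
Proof. by move=> x y; apply/join_ext => t; rewrite !jaddE addrC. Qed.
Fact jadd0 : left_id jzero jadd.
Proof. by move=> x; apply/join_ext => t; rewrite !jaddE add0r. Qed.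
Fact jaddN : left_inverse jzero jopp jadd.
Proof. by move=> x; apply/join_ext => t; rewrite jaddE joppE addNr. Qed.

HB.instance Definition _ := GRing.isZmodule.Build join jaddA jaddC jadd0 jaddN.

Lemma joinDE x y t : (x + y) t = x t + y t. Proof. exact: jaddE. Qed.
Lemma joinNE x t : (- x) t = - x t. Proof. exact: joppE. Qed.
Lemma join0E t : (0 : join) t = 0. Proof. by []. Qed.

Lemma join_sumE (I : Type) (r : seq I) (P : pred I) (F : I -> join) t :
  (\sum_(i <- r | P i) F i) t = \sum_(i <- r | P i) F i t.
Proof.
by apply: (big_morph (fun x => jfun x t)) => [x y|]; rewrite (joinDE, join0E).
Qed.

Fact jscaleA (k l : R[i]) x : jscale k (jscale l x) = jscale (k * l) x.
Proof. by apply/join_ext => t; rewrite !jscaleE scalerA. Qed.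
Fact jscale1 : left_id 1 jscale.
Proof. by move=> x; apply/join_ext => t; rewrite !jscaleE scale1r. Qed.
Fact jscaleDr : right_distributive jscale +%R.
Proof.
by move=> k x y; apply/join_ext => t; rewrite joinDE !jscaleE joinDE scalerDr.
Qed.
Fact jscaleDl x : {morph jscale^~ x : k l / k + l}.
Proof.
by move=> k l; apply/join_ext => t; rewrite joinDE !jscaleE scalerDl.
Qed.

HB.instance Definition _ :=
  GRing.Zmodule_isLmodule.Build R[i] join jscaleA jscale1 jscaleDr jscaleDl.

Lemma joinZE (k : R[i]) x t : (k *: x) t = k *: x t.
Proof. exact: jscaleE. Qed.

Fact jmulA : associative jmul.
Proof. by move=> x y z; apply/join_ext => t; rewrite !jmulE mulrA. Qed.
Fact jmul1 : left_id jone jmul.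
Proof. by move=> x; apply/join_ext => t; rewrite !jmulE mul1r. Qed.
Fact jmulr1 : right_id jone jmul.
Proof. by move=> x; apply/join_ext => t; rewrite !jmulE mulr1. Qed.
Fact jmulDl : left_distributive jmul +%R.
Proof.
by move=> x y z; apply/join_ext => t; rewrite joinDE !jmulE joinDE mulrDl.
Qed.
Fact jmulDr : right_distributive jmul +%R.
Proof.
by move=> x y z; apply/join_ext => t; rewrite joinDE !jmulE joinDE mulrDr.
Qed.
Fact jone_neq0 : jone != 0.
Proof.
by apply/eqP => /join_ext /(_ (unitI0 R)) /eqP; rewrite join0E oner_eq0.
Qed.

HB.instance Definition _ := GRing.Zmodule_isNzRing.Build join
  jmulA jmul1 jmulr1 jmulDl jmulDr jone_neq0.

Lemma joinME x y t : (x * y) t = x t * y t. Proof. by []. Qed.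
Lemma join1E t : (1 : join) t = 1. Proof. by []. Qed.

Fact jscaleAl (k : R[i]) x y : k *: (x * y) = (k *: x) * y.
Proof.
by apply/join_ext => t; rewrite joinZE !joinME joinZE scalerAl.
Qed.
Fact jscaleAr (k : R[i]) x y : k *: (x * y) = x * (k *: y).
Proof.
by apply/join_ext => t; rewrite joinZE !joinME joinZE scalerAr.
Qed.

HB.instance Definition _ :=
  GRing.LSemiModule_isLSemiAlgebra.Build R[i] join jscaleAl.
HB.instance Definition _ :=
  GRing.LSemiAlgebra_isSemiAlgebra.Build R[i] join jscaleAr.

Lemma join_continuous x : ncontinuous x. Proof. by case: (jcond x). Qed.

Lemma join0P x : exists a : A, x (unitI0 R) = coact a.
Proof. by case: (jcond x). Qed.

Lemma join1P x : exists h : groupAlg R G, x (unitI1 R) = oneT h.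
Proof. by case: (jcond x). Qed.

Definition jnorm x : R := sup [set anorm (x t) | t in [set: unitI R]].

Lemma le_jnorm x t : anorm (x t) <= jnorm x.
Proof.
apply: sup_ubound; last by exists t.
have [M xM] := ncontinuous_bounded (@join_continuous x).
by exists M => _ [s _ <-].
Qed.

Lemma jnorm_le x (M : R) : (forall t, anorm (x t) <= M) -> jnorm x <= M.
Proof.
move=> xM; apply: ge_sup => [|_ [t _ <-]//].
by exists (anorm (x (unitI0 R))), (unitI0 R).
Qed.

Fact jnorm_eq0 x : jnorm x = 0 -> x = 0.
Proof.
move=> x0; apply/join_ext => t; apply: anorm_eq0; apply/eqP.
by rewrite eq_le anorm_ge0 -x0 le_jnorm.
Qed.

Fact jnormD x y : jnorm (x + y) <= jnorm x + jnorm y.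
Proof.
apply: jnorm_le => t; rewrite joinDE (le_trans (anormD _ _)) //.
by rewrite lerD ?le_jnorm.
Qed.

Fact jnormM x y : jnorm (x * y) <= jnorm x * jnorm y.
Proof.
apply: jnorm_le => t; rewrite joinME (le_trans (anormM _ _)) //.
by rewrite ler_pM ?le_jnorm ?anorm_ge0.
Qed.

Let normc_ge0 (k : R[i]) : 0 <= normc k.
Proof. by case: k => a b; exact: sqrtr_ge0. Qed.

Let jnormZ_le (k : R[i]) x : jnorm (k *: x) <= normc k * jnorm x.
Proof.
by apply: jnorm_le => t; rewrite joinZE anormZ ler_wpM2l ?le_jnorm.
Qed.

Fact jnormZ (k : R[i]) x : jnorm (k *: x) = normc k * jnorm x.
Proof.
apply/eqP; rewrite eq_le jnormZ_le /=.
have [->|k0] := eqVneq k 0.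
  by rewrite normc0 mul0r (le_trans (anorm_ge0 _) (le_jnorm _ (unitI0 R))).
have nk0 : 0 < normc k.
  by rewrite lt_neqAle normc_ge0 andbT eq_sym; apply: contra k0 => /eqP/eq0_normc->.
rewrite -ler_pdivlMl // -normcV -[X in jnorm X](scale1r x) -(mulVf k0) -scalerA.
exact: jnormZ_le.
Qed.

HB.instance Definition _ :=
  Algebra_hasNorm.Build R join jnorm_eq0 jnormD jnormZ jnormM.

(* (delta_Delta f)(t) = (id (x) Delta)(f t), where the tensor factor H on the
   right is pulled out of C([0, 1], (A (x) H) (x) H): the coefficient of
   delta_Delta f at g is the path t |-> (coefficient of (id (x) Delta)(f t)
   at g). *)
Fact join_cond_coact x (g : G) : join_cond (fun t => idDelta (x t) g).
Proof.
split.
- apply: (@ncontinuous_le _ _ _ (fun t s => anorm (x s - x t))) => [t s|t].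
    rewrite !tensE -[X in _ - X]scale1r -scaleN1r scale1r -pureTZ -pureTD.
    rewrite anorm_pureT scaleN1r -tensNE -tensDE.
    exact: anorm_coef_le.
  exact: join_continuous.
- have [a xa] := join0P x; exists (coact a g).
  by rewrite xa -coactA tensE.
- have [h xh] := join1P x; exists (idDelta h g).
  rewrite xh; apply/tensP => k; rewrite !tensE.
  by case: eqP; rewrite ?scale0r.
Qed.

Definition jcoact x : tensH join G := \tens_g mk (join_cond_coact x g).

Lemma jcoactE x (g : G) t : jcoact x g t = idDelta (x t) g.
Proof. by rewrite tensE. Qed.

Fact jcoact_linear (k : R[i]) x y :
  jcoact (k *: x + y) = k *: jcoact x + jcoact y.
Proof.
apply/tensP => g; apply/join_ext => t; rewrite tensDE tensZE joinDE joinZE.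
by rewrite !jcoactE joinDE joinZE idDelta_linear tensDE tensZE.
Qed.

Fact jcoact1 : jcoact 1 = 1.
Proof.
apply/tensP => g; apply/join_ext => t; rewrite jcoactE join1E idDelta1 !tensE.
by case: eqP.
Qed.

Fact jcoactM x y : jcoact (x * y) = jcoact x * jcoact y.
Proof.
apply/tensP => g; apply/join_ext => t; rewrite jcoactE joinME idDeltaM.
rewrite !tensME join_sumE; apply: eq_bigr => h _.
by rewrite joinME !jcoactE.
Qed.

Fact jcoact_bounded : exists M, forall x, anorm (jcoact x) <= M * anorm x.
Proof.
exists (#|G|%:R) => x; rewrite tensnormE mulr_natl -sumr_const.
apply: ler_sum => g _; apply: jnorm_le => t; rewrite jcoactE tensE anorm_pureT.
exact: le_trans (anorm_coef_le _ _) (le_jnorm _ _).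
Qed.

Fact jcoactA x : mapH jcoact (jcoact x) = idDelta (jcoact x).
Proof.
apply/tensP => g; apply/tensP => h; apply/join_ext => t.
have -> : mapH jcoact (jcoact x) g = jcoact (jcoact x g) by rewrite tensE.
have := tens_coactA (x t) => /tensP /(_ g).
rewrite [LHS]tensE => /tensP /(_ h) E.
rewrite !jcoactE E [idDelta (idDelta _) g]tensE [idDelta (jcoact x) g]tensE.
rewrite [LHS]tensE [coef (pureT _ _) h]tensE.
by case: eqP => [_|//]; rewrite jcoactE.
Qed.

Fact jcoact_counit x : idEps (jcoact x) = x.
Proof.
apply/join_ext => t; rewrite /idEps join_sumE -[RHS]tens_counit.
by apply: eq_bigr => g _; rewrite jcoactE.
Qed.

HB.instance Definition _ := NormedAlgebra_hasCoaction.Build R G join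
  jcoact_linear jcoact1 jcoactM jcoact_bounded jcoactA jcoact_counit.

End Join.

(* E_n H *)
Fixpoint iterated_join (R : realType) (G : finGroupType) (n : nat) :
    comodAlgType R G :=
  if n is m.+1 then join (iterated_join R G m) else groupAlg R G.

Section Cleft.
Variables (R : realType) (G : finGroupType) (A : comodAlgType R G).
Let H := groupAlg R G.
Implicit Types phi psi : H -> A.

Definition counit (h : H) : R[i] := \sum_g h g.

Definition comodule_map phi :=
  forall h : H, coact (phi h) = mapH phi (coact h).

(* mult o (phi (x) psi) on H (x) H *)
Definition mult_tens phi psi (x : tensH H G) : A :=
  \sum_g phi (x g) * psi (pureT 1 g).

Definition convolution phi psi (h : H) : A := mult_tens phi psi (coact h).

Definition conv_unit (h : H) : A := counit h *: 1.

Definition cleft : Prop :=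
  exists phi : {linear H -> A}, comodule_map phi /\
  exists psi : {linear H -> A},
    convolution phi psi = conv_unit /\ convolution psi phi = conv_unit.

End Cleft.

Arguments cleft {R G} A.

(* Main.v *)
Require Import Defs.
From HB Require Import structures.
From mathcomp Require Import all_boot all_order all_algebra all_fingroup.
From mathcomp Require Import all_solvable all_field all_character.
From mathcomp Require Import complex ring lra.
From mathcomp Require Import all_classical reals topology normedtype.
From mathcomp Require Import sequences exp trigo.

(** A coaction of the group algebra CG on A is a G-grading of A, and a cleaving
map is the choice of a unit in every degree ([cleftP]). A homogeneous element
of degree g of the join of A with CG is, up to the factor g, a path in A from
an element of degree g to a scalar. Hence the join of A is cleft as soon as,
for every g, some unit of degree g can be deformed to 1 inside the group of
units of A; call g contractible in A in that case ([cleft_join]).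

Perfect groups. The contractible degrees of A form a subgroup. In CG itself
every g is contractible: g has finite order, so g is a combination of
orthogonal idempotents with roots of unity as coefficients, and each coefficient
can be moved to 1 in C^* ([group_path]). Suppose that all degrees are
contractible in A. A unit of degree g of the join of A is then represented by a
path from delta(u) to 1 (x) g, both of whose end points can be deformed to 1
inside the subalgebra allowed at that end. Deforming the right end, one reaches
a path that is 1 on [1/2, 1]; deforming the left end, one reaches a path that
is 1 on [0, 1/2]. A path of the first kind commutes with a path of the second
kind, so every commutator is contractible in the join of A
([contractible_commutator]). This is the argument that shows that the
fundamental group of a topological group is abelian. If G is perfect,
all degrees are thus contractible in every iterated join, by induction.

The paths used in this direction are Lipschitz with Lipschitz inverse. A
reparametrization (s, t) |-> W (r s t) of a Lipschitz path W is then visibly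
continuous in s for the supremum norm over t, with no appeal to compactness.

Groups that are not perfect. Evaluation at 0 maps the join of A equivariantly
onto A, so it is enough to treat E_2 ([cleft_join_base]). A unit of degree g of
E_2 is a path s |-> y s of units of E_1 from a unit of degree g to a scalar. Let
chi be a linear character with chi^N = 1, and let u_jk (s, t) be the nonzero
complex number obtained by applying chi^j (x) chi^k to y s t. The end conditions
in E_1 say that u_jk (s, 0) depends on j + k only, and u_jk (s, 1) on k only.
Therefore u_{j+2,0} u_{j,1} / (u_{j+1,0} u_{j+1,1}) is, for each s, a loop in
C^* based at 1. It is constant for s = 1, so for s = 0 it is null-homotopic and
is the N-th power of a loop based at 1. For s = 0 this loop is r_{j+1} / r_j,
where r_j is the quotient of the paths obtained from chi^{j+1} and chi^j. As the
product of r_0, ..., r_{N-1} is 1, the path r_0 times a loop based at 1 takes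
its values in the N-th roots of unity, hence is constant; since r_0 goes from
chi g to 1, this forces chi g = 1 ([winding_obstruction], [char_trivial]). A
group all of whose linear characters are trivial is perfect ([exists_char]). *)

Set Implicit Arguments.
Unset Strict Implicit.
Unset Printing Implicit Defensive.

Import Order.TTheory GRing.Theory Num.Theory.
Import numFieldNormedType.Exports.
Import ComplexField.Normc.

Local Open Scope classical_set_scope.
Local Open Scope ring_scope.
Local Open Scope complex_scope.

(** * Mutually inverse elements *)

Section Inverses.
Variable R : realType.

Definition inverses (A : normedAlgType R) (x y : A) := x * y = 1 /\ y * x = 1.

Lemma inverses_uniq (A : normedAlgType R) (x y z : A) :
  inverses x y -> inverses x z -> y = z.
Proof.
by move=> [_ yx] [xz _]; rewrite -[y]mulr1 -xz mulrA yx mul1r.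
Qed.

Lemma inversesC (A : normedAlgType R) (x y : A) : inverses x y -> inverses y x.
Proof. by case. Qed.

Lemma inversesM (A : normedAlgType R) (x y x' y' : A) :
  inverses x y -> inverses x' y' -> inverses (x * x') (y' * y).
Proof.
move=> [xy yx] [xy' yx']; split.
  by rewrite mulrA -(mulrA x) xy' mulr1.
by rewrite mulrA -(mulrA y') yx mulr1.
Qed.

End Inverses.

(** * Homogeneous elements and cleftness *)

Section Homogeneous.
Variables (R : realType) (G : finGroupType).

Definition homogeneous (A : comodAlgType R G) (g : G) (x : A) : Prop :=
  coact x = pureT x g.

Variable A : comodAlgType R G.

Lemma homogeneous1 : homogeneous 1%g (1 : A).
Proof. by rewrite /homogeneous coact1. Qed.

Lemma homogeneousM (g h : G) (x y : A) :
  homogeneous g x -> homogeneous h y -> homogeneous (g * h)%g (x * y).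
Proof. by rewrite /homogeneous coactM => -> ->; rewrite pureTM. Qed.

Lemma coactZ (k : R[i]) (x : A) : coact (k *: x) = k *: coact x :> tensH A G.
Proof.
have c0 : coact (0 : A) = 0 :> tensH A G.
  have := @coact_linear R G A (-1) (0 : A) 0.
  by rewrite scaler0 addr0 scaleN1r addNr.
by rewrite -[in LHS](addr0 (k *: x)) coact_linear c0 addr0.
Qed.

Lemma homogeneousZ g (k : R[i]) (x : A) :
  homogeneous g x -> homogeneous g (k *: x).
Proof. by rewrite /homogeneous coactZ pureTZ => ->. Qed.

Lemma coactB (a b : A) : coact (a - b) = coact a - coact b :> tensH A G.
Proof.
by rewrite addrC -scaleN1r (@coact_linear R G A) scaleN1r addrC.
Qed.

Lemma homogeneousV g (x y : A) :
  inverses x y -> homogeneous g x -> homogeneous g^-1%g y.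
Proof.
move=> [xy yx] hx; apply: (@inverses_uniq _ _ (coact x)).
  by split; rewrite -coactM ?xy ?yx coact1.
by rewrite hx; split; rewrite pureTM ?xy ?yx (mulgV, mulVg).
Qed.

Lemma pureTB (B : normedAlgType R) (g : G) (a b : B) :
  pureT (a - b) g = pureT a g - pureT b g.
Proof. by rewrite -scaleN1r pureTD pureTZ scaleN1r. Qed.

Let H := groupAlg R G.

(** Restates the coordinatewise operations at the type [groupAlg R G], whose
algebra structure is only found after unfolding. *)
Lemma groupAlg_linE (k : R[i]) (a b : H) (g : G) :
  (k *: a + b) g = k * a g + b g.
Proof. by rewrite [LHS](@tensDE R G R[i]^o) tensZE. Qed.

Lemma coact_pureT (a : R[i]^o) (g : G) (h : G) :
  coact (pureT a g : H) h = if h == g then pureT a g else 0.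
Proof.
rewrite tensE; case: eqP => [->|/eqP/negbTE hg]; first by rewrite tensE eqxx.
by rewrite tensE hg; apply/tensP => k; rewrite tensE tens0E if_same.
Qed.

(** As Delta g = g (x) g, the convolution product of two linear maps is their
pointwise product on group elements, and a linear map is a comodule map exactly
when it sends each g to an element of degree g. *)
Lemma cleftP : cleft A <->
  forall g : G, exists x y : A, homogeneous g x /\ inverses x y.
Proof.
split=> [[phi [cphi [psi [e1 e2]]]] g|xy].
  have conv (p q : {linear H -> A}) :
      convolution p q (pureT 1 g) = p (pureT 1 g) * q (pureT 1 g).
    rewrite /convolution /mult_tens (bigD1 g) //= coact_pureT eqxx.
    rewrite big1 ?addr0 //.
    by move=> h hg; rewrite coact_pureT (negbTE hg) linear0 mul0r.
  have cu : conv_unit A (pureT 1 g : H) = 1.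
    rewrite /conv_unit /counit (bigD1 g) //= big1 ?addr0.
      by rewrite tensE eqxx scale1r.
    by move=> h hg; rewrite tensE (negbTE hg).
  exists (phi (pureT 1 g)), (psi (pureT 1 g)); split.
    rewrite /homogeneous cphi; apply/tensP => h.
    rewrite /mapH tensE [RHS]tensE coact_pureT; case: eqP => // _.
    by rewrite linear0.
  by split; [rewrite -conv e1 cu|rewrite -conv e2 cu].
have /choice[x /choice[y h]] := xy.
pose L (f : G -> A) (a : H) : A := \sum_g a g *: f g.
have Llin f : linear (L f).
  move=> k a b; rewrite /L scaler_sumr -big_split /=; apply: eq_bigr => g _.
  by rewrite groupAlg_linE scalerDl scalerA.
pose LL f : {linear H -> A} :=
  HB.pack (L f) (GRing.isLinear.Build R[i] H A *:%R (L f) (Llin f)).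
have LE f a : LL f a = \sum_g a g *: f g by [].
have Lpure f (c : R[i]^o) g : LL f (pureT c g) = c *: f g.
  rewrite LE (bigD1 g) //= big1 ?addr0; first by rewrite tensE eqxx.
  by move=> k kg; rewrite tensE (negbTE kg) scale0r.
have coactL a g : coact (a : H) g = pureT (a g) g by rewrite tensE.
have convL f1 f2 : (forall g, f1 g * f2 g = 1) ->
    convolution (LL f1) (LL f2) = conv_unit A (G:=G).
  move=> f12; apply/funext => a.
  rewrite /convolution /mult_tens /conv_unit /counit scaler_suml.
  apply: eq_bigr => g _.
  by rewrite coactL !Lpure scale1r -scalerAl f12.
exists (LL x); split.
  move=> a; apply/tensP => g; rewrite /mapH [RHS]tensE coactL Lpure.
  have csum : coact (LL x a) = \sum_g coact (a g *: x g) :> tensH A G.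
    rewrite LE; apply: (big_morph (@coact R G A)).
      move=> u v; have := @coact_linear R G A 1 u v.
      by rewrite !scale1r.
    by have := coactZ 0 (1 : A); rewrite !scale0r.
  rewrite csum tens_sumE (bigD1 g) //= big1 ?addr0.
    have [hx _] := h g.
    by rewrite (homogeneousZ (a g) hx) tensE eqxx.
  move=> k kg; have [hx _] := h k.
  by rewrite (homogeneousZ (a k) hx) tensE eq_sym (negbTE kg).
by exists (LL y); split; apply: convL => g; have [_ []] := h g.
Qed.

End Homogeneous.

(** * Lipschitz paths of units *)

Section Bounded.
Variable R : realType.

(** One constant serves both as a bound and as a Lipschitz constant; boundedness
is what makes the class stable under products. *)
Definition bounded_lipschitz (A : normedAlgType R) (f : R -> A) := exists K : R,
  forall s t, anorm (f t) <= K /\ anorm (f s - f t) <= K * `|s - t|.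

Lemma bounded_lipschitz_cst (A : normedAlgType R) (a : A) :
  bounded_lipschitz (fun=> a).
Proof.
exists (anorm a) => s t; split=> //.
by rewrite subrr anorm0 mulr_ge0 ?anorm_ge0.
Qed.

Lemma bounded_lipschitzM (A : normedAlgType R) (f g : R -> A) :
  bounded_lipschitz f -> bounded_lipschitz g ->
  bounded_lipschitz (fun t => f t * g t).
Proof.
move=> [K fK] [L gL].
have K0 : 0 <= K by apply: le_trans (anorm_ge0 _) (proj1 (fK 0 0)).
have L0 : 0 <= L by apply: le_trans (anorm_ge0 _) (proj1 (gL 0 0)).
exists (K * L *+ 2) => s t; split.
  rewrite (le_trans (anormM _ _)) // (@le_trans _ _ (K * L)) //.
    rewrite ler_pM ?anorm_ge0 //; first by have [] := fK 0 t.
    by have [] := gL 0 t.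
  by rewrite mulr2n lerDl mulr_ge0.
have -> : f s * g s - f t * g t = (f s - f t) * g s + f t * (g s - g t).
  by rewrite mulrBl mulrBr addrA subrK.
rewrite (le_trans (anormD _ _)) // mulr2n [X in _ <= X]mulrDl lerD //.
  rewrite (le_trans (anormM _ _)) // mulrAC ler_pM ?anorm_ge0 //.
    by have [] := fK s t.
  by have [] := gL 0 s.
rewrite (le_trans (anormM _ _)) // -mulrA ler_pM ?anorm_ge0 //.
  by have [] := fK 0 t.
by have [] := gL s t.
Qed.

Lemma bounded_lipschitzD (A : normedAlgType R) (f g : R -> A) :
  bounded_lipschitz f -> bounded_lipschitz g ->
  bounded_lipschitz (fun t => f t + g t).
Proof.
move=> [K fK] [L gL]; exists (K + L) => s t; split.
  rewrite (le_trans (anormD _ _)) // lerD //.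
    by have [] := fK s t.
  by have [] := gL s t.
rewrite opprD addrACA mulrDl (le_trans (anormD _ _)) // lerD //.
  by have [] := fK s t.
by have [] := gL s t.
Qed.

Lemma bounded_lipschitz_sum (A : normedAlgType R) (I : Type) (r : seq I)
    (F : I -> R -> A) :
  (forall i, bounded_lipschitz (F i)) ->
  bounded_lipschitz (fun t => \sum_(i <- r) F i t).
Proof.
move=> hF; elim: r => [|i r IH].
  by have -> : (fun t => \sum_(i <- [::]) F i t) = (fun=> 0 : A);
     [apply/funext => t; rewrite big_nil|exact: bounded_lipschitz_cst].
have -> : (fun t => \sum_(j <- i :: r) F j t) =
    fun t => F i t + \sum_(j <- r) F j t.
  by apply/funext => t; rewrite big_cons.
exact: bounded_lipschitzD.
Qed.

Lemma bounded_lipschitz_map (A B : normedAlgType R) (phi : A -> B) (M : R)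
    (f : R -> A) :
  (forall a b, phi (a - b) = phi a - phi b) ->
  (forall a, anorm (phi a) <= M * anorm a) ->
  bounded_lipschitz f -> bounded_lipschitz (phi \o f).
Proof.
move=> phiB phiM [K fK].
have K0 : 0 <= K by apply: le_trans (anorm_ge0 _) (proj1 (fK 0 0)).
have phiM' a L : anorm a <= L -> anorm (phi a) <= `|M| * L.
  move=> aL; rewrite (le_trans (phiM a)) // (@le_trans _ _ (`|M| * anorm a)) //.
    by rewrite ler_wpM2r ?anorm_ge0 ?ler_norm.
  by rewrite ler_wpM2l.
exists (`|M| * K) => s t; split; first by apply: phiM'; have [] := fK s t.
by rewrite /= -phiB -mulrA; apply: phiM'; have [] := fK s t.
Qed.

Lemma bounded_lipschitz_comp (A : normedAlgType R) (f : R -> A) (r : R -> R)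
    (L : R) :
  (forall s t, `|r s - r t| <= L * `|s - t|) ->
  bounded_lipschitz f -> bounded_lipschitz (f \o r).
Proof.
move=> rL [K fK].
have K0 : 0 <= K by apply: le_trans (anorm_ge0 _) (proj1 (fK 0 0)).
exists (K * (1 + `|L|)) => s t; split.
  by rewrite mulrDr mulr1 ler_wpDr ?mulr_ge0 //; have [] := fK 0 (r t).
rewrite (le_trans (proj2 (fK (r s) (r t)))) // -mulrA ler_wpM2l //.
rewrite (le_trans (rL s t)) // ler_wpM2r //.
by rewrite (le_trans (ler_norm _)) // lerDr.
Qed.

(** The inverse path z is part of the data: it has to be Lipschitz as well, and
carrying it avoids inverting in an algebra without an inverse operation. *)
Definition unit_path (A : normedAlgType R) (y z : R -> A) :=
  [/\ bounded_lipschitz y, bounded_lipschitz z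
    & forall t, inverses (y t) (z t)].

Lemma unit_pathC (A : normedAlgType R) (y z : R -> A) :
  unit_path y z -> unit_path z y.
Proof. by move=> [? ? h]; split=> // t; apply: inversesC. Qed.

Lemma unit_pathM (A : normedAlgType R) (y z y' z' : R -> A) :
  unit_path y z -> unit_path y' z' ->
  unit_path (fun t => y t * y' t) (fun t => z' t * z t).
Proof.
move=> [? ? h] [? ? h']; split; try exact: bounded_lipschitzM.
by move=> t; apply: inversesM.
Qed.

Lemma unit_path_cst (A : normedAlgType R) (x y : A) :
  inverses x y -> unit_path (fun=> x) (fun=> y).
Proof. by move=> h; split=> [||_] //; apply: bounded_lipschitz_cst. Qed.

Lemma unit_path_comp (A : normedAlgType R) (y z : R -> A) (r : R -> R) (L : R) :
  (forall s t, `|r s - r t| <= L * `|s - t|) ->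
  unit_path y z -> unit_path (y \o r) (z \o r).
Proof.
move=> rL [? ? h]; split; try exact: bounded_lipschitz_comp rL _.
by move=> t; apply: h.
Qed.

Lemma unit_path_map (A B : normedAlgType R) (phi : A -> B) (M : R)
    (y z : R -> A) :
  (forall a b, phi (a - b) = phi a - phi b) ->
  (forall a b, phi (a * b) = phi a * phi b) -> phi 1 = 1 ->
  (forall a, anorm (phi a) <= M * anorm a) ->
  unit_path y z -> unit_path (phi \o y) (phi \o z).
Proof.
move=> phiB phiM phi1 bphi [? ? h].
split; try exact: bounded_lipschitz_map phiB bphi _.
by move=> t; case: (h t) => yz zy; split; rewrite /= -phiM ?yz ?zy.
Qed.

Definition clamp (s : R) : R := Num.max 0 (Num.min s 1).

Lemma clamp_ge0 s : 0 <= clamp s. Proof. by rewrite le_max lexx. Qed.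
Lemma clamp_le1 s : clamp s <= 1.
Proof. by rewrite ge_max ler01 ge_min lexx orbT. Qed.
Lemma clamp_low s : s <= 0 -> clamp s = 0.
Proof.
by move=> s0; rewrite /clamp min_l ?max_l // (le_trans s0).
Qed.
Lemma clamp_high s : 1 <= s -> clamp s = 1.
Proof. by move=> s1; rewrite /clamp min_r // max_r. Qed.
Lemma clamp_lip s t : `|clamp s - clamp t| <= `|s - t|.
Proof.
rewrite /clamp; have [s1|s1] := leP s 1; have [t1|t1] := leP t 1;
  have [s0|s0] := leP 0 s; have [t0|t0] := leP 0 t;
  rewrite ?(max_r ler01) ?(max_l (ltW s0)) ?(max_l (ltW t0));
  rewrite ?(max_r s0) ?(max_r t0) ler_norml;
  have [?|?] := ger0P (s - t); apply/andP; split; lra.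
Qed.

End Bounded.

(** * Contractible degrees *)

Section Contraction.
Variables (R : realType) (G : finGroupType) (A : comodAlgType R G).

(** The path is constant outside [0, 1], so that shifted, reversed and rescaled
copies of it can be multiplied together without any case distinction. *)
Definition contracting_path (g : G) (y z : R -> A) :=
  [/\ unit_path y z, homogeneous g (y 0), forall t, t <= 0 -> y t = y 0
    & forall t, 1 <= t -> y t = 1].

Definition contractible (g : G) := exists y z : R -> A, contracting_path g y z.

Lemma contracting_path_inv g (y z : R -> A) : contracting_path g y z ->
  [/\ homogeneous g^-1%g (z 0), forall t, t <= 0 -> z t = z 0
    & forall t, 1 <= t -> z t = 1].
Proof.
move=> [[_ _ yz] y0 yl yr]; split; first exact: homogeneousV (yz 0) y0.
  move=> t t0; apply: (@inverses_uniq _ _ (y 0)); last exact: yz.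
  by rewrite -(yl t t0); apply: yz.
move=> t t1; apply: (@inverses_uniq _ _ (y t)); first exact: yz.
by rewrite yr //; split; rewrite mulr1.
Qed.

Lemma contractible1 : contractible 1%g.
Proof.
exists (fun=> 1), (fun=> 1); split=> //; last exact: homogeneous1.
by apply: unit_path_cst; split; rewrite mulr1.
Qed.

Lemma contractibleM g h : contractible g -> contractible h ->
  contractible (g * h)%g.
Proof.
move=> [y [z [yz y0 yl yr]]] [y' [z' [yz' y0' yl' yr']]].
exists (fun t => y t * y' t), (fun t => z' t * z t); split.
- exact: unit_pathM.
- exact: homogeneousM.
- by move=> t t0; rewrite yl // yl'.
- by move=> t t0; rewrite yr // yr' // mulr1.
Qed.

Lemma val_continuous : continuous (val : unitI R -> R).
Proof. exact: initial_continuous. Qed.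

Lemma ncontinuous_lip (B : normedAlgType R) (f : unitI R -> B) (K : R) :
  (forall s t, anorm (f s - f t) <= K * `|val s - val t|) -> ncontinuous f.
Proof.
move=> fK; apply: (ncontinuous_le (fun t s => fK s t)) => t.
have cv : (val : unitI R -> R) s - val t @[s --> t] --> val t - val t.
  by apply: cvgB; [exact: val_continuous|exact: cvg_cst].
have := @cvgM _ _ _ _ _ _ K _ (cvg_cst K) (cvg_norm cv).
have -> : K * `|val t - val t| = 0 by rewrite subrr normr0 mulr0.
by move=> cc; exact: cc.
Qed.

Lemma join_mk (f : unitI R -> tensH A G) : join_cond f ->
  exists x : join A, forall t, x t = f t.
Proof. by move=> h; exists (Join (asboolT h)). Qed.

Lemma join_coactE (x : join A) g t :
  (coact x : tensH (join A) G) g t = pureT (x t g) g.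
Proof. by rewrite jcoactE tensE. Qed.

Lemma homogeneous_join (x : join A) (g : G) (y : unitI R -> A) :
  (forall t, x t = pureT (y t) g) -> homogeneous g x.
Proof.
move=> xy; apply/tensP => h; apply/join_ext => t.
rewrite join_coactE xy !tensE; case: eqP => [->|_]; first by rewrite xy.
by rewrite join0E; apply/tensP => k; rewrite tensE tens0E if_same.
Qed.

Lemma oneT_pure (g : G) : oneT A (pureT (1 : R[i]^o) g) = pureT 1 g.
Proof.
by apply/tensP => h; rewrite !tensE; case: eqP; rewrite ?scale1r ?scale0r.
Qed.

(** A contraction of g in A, tensored with g, is a unit of degree g of the join:
its value at 0 is delta (y 0) because y 0 has degree g, and its value at 1 is
1 (x) g. *)
Lemma cleft_join : (forall g, contractible g) -> cleft (join A).
Proof.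
move=> hg; apply/cleftP => g; have [y [z [[by_ bz yz] y0 yl yr]]] := hg g.
have mk (w : R -> A) k :
    bounded_lipschitz w -> homogeneous k (w 0) -> w 1 = 1 ->
    exists x : join A, forall t, x t = pureT (w (val t)) k.
  move=> bw w0 w1; apply: join_mk; split.
  - have [K wK] := bw; apply: (@ncontinuous_lip _ _ K) => s t.
    by rewrite -pureTB anorm_pureT; have [] := wK (val s) (val t).
  - by exists (w 0); rewrite w0.
  - by exists (pureT 1 k); rewrite w1 oneT_pure.
have z1 : z 1 = 1.
  apply: (@inverses_uniq _ _ (y 1)); first exact: yz.
  by rewrite yr //; split; rewrite mulr1.
have [Y hY] := mk y g by_ y0 (yr _ (lexx _)).
have [Z hZ] := mk z _ bz (homogeneousV (yz 0) y0) z1.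
exists Y, Z; split; first exact: homogeneous_join hY.
split; apply/join_ext => t; rewrite joinME hY hZ pureTM ?mulgV ?mulVg;
  by have [yz1 zy1] := yz (val t); rewrite ?yz1 ?zy1.
Qed.

End Contraction.

(** * Commutators are contractible in the join *)

Section CommutatorContraction.
Variables (R : realType) (G : finGroupType) (A : comodAlgType R G).
Let H := groupAlg R G.

Lemma oneTB (a b : H) : oneT A (a - b) = oneT A a - oneT A b.
Proof. by rewrite addrC -scaleN1r oneT_linear scaleN1r addrC. Qed.

Lemma anorm_oneT (a : H) : anorm (oneT A a) <= anorm (1 : A) * anorm a.
Proof.
rewrite tensnormE [X in _ <= _ * X]tensnormE mulr_sumr; apply: ler_sum => g _.
by rewrite tensE anormZ mulrC.
Qed.

Lemma unit_path_pureT (y z : R -> A) :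
  unit_path y z ->
  unit_path (fun t => pureT (y t) (1%g : G)) (fun t => pureT (z t) (1%g : G)).
Proof.
apply: (@unit_path_map _ _ (tensH A G) (fun a => pureT a 1%g) 1).
- by move=> a b; rewrite pureTB.
- by move=> a b; rewrite pureTM mulg1.
- by [].
- by move=> a; rewrite anorm_pureT mul1r.
Qed.

Lemma unit_path_coact (y z : R -> A) :
  unit_path y z ->
  unit_path (fun t => coact (y t) : tensH A G)
            (fun t => coact (z t) : tensH A G).
Proof.
have [M hM] := @coact_bounded R G A.
apply: (@unit_path_map _ _ (tensH A G) (@coact R G A) M) => //.
- exact: coactB.
- exact: coactM.
- exact: coact1.
Qed.

Lemma unit_path_oneT (y z : R -> H) :
  unit_path y z -> unit_path (fun t => oneT A (y t)) (fun t => oneT A (z t)).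
Proof.
apply: (@unit_path_map _ _ (tensH A G) (@oneT R G A) (anorm (1 : A))) => //.
- exact: oneTB.
- exact: oneTM.
- exact: oneT1.
- exact: anorm_oneT.
Qed.

(** The values allowed at t <= 0 and at t >= 1 for a path in A (x) CG, every
segment of which from ]-oo, 0] to [1, +oo[ is then an element of the join. *)
Definition liftable (W : R -> tensH A G) :=
  (forall t, t <= 0 -> exists a : A, W t = coact a) /\
  (forall t, 1 <= t -> exists h : H, W t = oneT A h).

(** Prolongs the path y (x) g beyond t = 1, where it has reached 1 (x) g, by the
contraction 1 (x) p of g inside 1 (x) CG. The prolonged path is the product of
the two contractions, the second one being shifted by 1. *)
Lemma right_extension g (y z : R -> A) (p q : R -> H) :
  contracting_path g y z -> contracting_path g p q -> p 0 = pureT 1 g ->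
  exists U U' : R -> tensH A G,
  [/\ unit_path U U', liftable U, liftable U',
      forall t, t <= 1 -> U t = pureT (y t) g & forall t, 2 <= t -> U t = 1].
Proof.
move=> yz pq p0.
have [z0 zl zr] := contracting_path_inv yz; case: yz => byz y0 yl yr.
have [_ ql qr] := contracting_path_inv pq.
have q0 : q 0 = pureT 1 g^-1%g.
  apply: (@inverses_uniq _ _ (p 0)); first by case: pq => [[_ _ pq] _ _ _].
  by rewrite p0; split; rewrite pureTM ?(mulgV, mulVg) mulr1.
case: pq => bpq _ pl pr.
have shift (s t : R) : `|(s - 1) - (t - 1)| <= 1 * `|s - t| :> R.
  by rewrite mul1r opprB addrA subrK.
have b1 := unit_path_pureT byz.
have b2 := unit_path_oneT (unit_path_comp shift bpq).
have E1 t : t <= 1 -> pureT (y t) 1%g * oneT A (p (t - 1)) = pureT (y t) g.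
  move=> t1; rewrite pl ?subr_le0 // p0 oneT_pure pureTM mulr1.
  by rewrite mul1g.
have E1' t : t <= 1 ->
    oneT A (q (t - 1)) * pureT (z t) 1%g = pureT (z t) g^-1%g.
  move=> t1; rewrite ql ?subr_le0 // q0 oneT_pure pureTM mul1r.
  by rewrite mulg1.
have pur1 : pureT 1 1%g = 1 :> tensH A G by [].
exists (fun t => pureT (y t) 1%g * oneT A (p (t - 1))).
exists (fun t => oneT A (q (t - 1)) * pureT (z t) 1%g); split.
- exact: unit_pathM b1 b2.
- split=> t t0.
    by exists (y 0); rewrite E1 ?(le_trans t0) // yl // y0.
  by exists (p (t - 1)); rewrite yr // pur1 mul1r.
- split=> t t0.
    by exists (z 0); rewrite E1' ?(le_trans t0) // zl // z0.
  by exists (q (t - 1)); rewrite zr // pur1 mulr1.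
- exact: E1.
- move=> t t2; rewrite yr; last by rewrite (le_trans _ t2) // ler1n.
  rewrite pr; last by rewrite lerBrDr.
  by rewrite oneT1 mulr1.
Qed.

(** Prolongs the path y (x) g before t = 0, where it is delta (y 0), by
the image under delta of the contraction y run backwards. The factor
delta (z 0) makes the two pieces match. *)
Lemma left_extension g (y z : R -> A) : contracting_path g y z ->
  exists V V' : R -> tensH A G,
  [/\ unit_path V V', liftable V, liftable V',
      forall t, 0 <= t -> V t = pureT (y t) g & forall t, t <= -1 -> V t = 1].
Proof.
move=> yz.
have [z0 zl zr] := contracting_path_inv yz; case: yz => byz y0 yl yr.
have yz : forall t, inverses (y t) (z t) by case: byz.
have opp (s t : R) : `|- s - - t| <= 1 * `|s - t|.
  by rewrite mul1r opprK addrC distrC.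
have b1 := unit_path_coact (unit_path_comp opp byz).
have b2 := unit_path_coact (unit_path_cst (inversesC (yz 0))).
have b3 := unit_path_pureT byz.
have i1 : inverses (pureT (1 : A) g) (pureT 1 g^-1%g).
  by split; rewrite pureTM ?(mulgV, mulVg) mulr1.
have b := unit_pathM (unit_pathM b1 b2) (unit_pathM b3 (unit_path_cst i1)).
move: b; set V := (fun t => _ * _); set V' := (fun t => _ * _) => b.
have VE t : V t = coact (y (- t)) * coact (z 0) * pureT (y t) g.
  by rewrite /V /= pureTM mulr1 mul1g.
have V'E t : V' t = pureT (z t) g^-1%g * (coact (y 0) * coact (z (- t))).
  by rewrite /V' /= pureTM mul1r mulg1.
have y0z0 : y 0 * z 0 = 1 by case: (yz 0).
have z0y0 : z 0 * y 0 = 1 by case: (yz 0).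
have Vr t : 0 <= t -> V t = pureT (y t) g.
  by move=> t0; rewrite VE (yl (- t)) ?oppr_le0 // -coactM y0z0 coact1 mul1r.
have V'r t : 0 <= t -> V' t = pureT (z t) g^-1%g.
  by move=> t0; rewrite V'E (zl (- t)) ?oppr_le0 // -coactM y0z0 coact1 mulr1.
have Vl t : t <= 0 -> V t = coact (y (- t)).
  move=> t0; rewrite VE (yl t t0) -y0. by rewrite -!coactM -mulrA z0y0 mulr1.
have V'l t : t <= 0 -> V' t = coact (z (- t)).
  by move=> t0; rewrite V'E (zl t t0) -z0 -!coactM mulrA z0y0 mul1r.
exists V, V'; split=> //.
- split=> t t0; first by exists (y (- t)); rewrite Vl.
  by exists (pureT 1 g); rewrite Vr ?(le_trans _ t0) // yr // oneT_pure.
- split=> t t0; first by exists (z (- t)); rewrite V'l.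
  by exists (pureT 1 g^-1%g); rewrite V'r ?(le_trans _ t0) // zr // oneT_pure.
- move=> t t1; rewrite Vl ?(le_trans t1) ?lerN10 // yr ?coact1 //.
  by rewrite lerNr.
Qed.

(** For each s, restricting W to the segment parametrized by [r s] gives a
unit of the join, and the Lipschitz constants of W and of r bound the distance
between two such units in the supremum norm. *)
Lemma join_path (W W' : R -> tensH A G) (r : R -> R -> R) (K L : R) :
  unit_path W W' -> liftable W -> liftable W' ->
  (forall s, r s 0 <= 0) -> (forall s, 1 <= r s 1) ->
  (forall s s' t, 0 <= t <= 1 -> `|r s t - r s' t| <= L * `|s - s'|) ->
  (forall s t t', `|r s t - r s t'| <= K * `|t - t'|) ->
  exists Y Y' : R -> join A, unit_path Y Y' /\
   (forall s t, Y s t = W (r s (val t)) /\ Y' s t = W' (r s (val t))).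
Proof.
move=> bW lW lW' r0 r1 rL rK.
have mk (X : R -> tensH A G) : bounded_lipschitz X -> liftable X ->
    exists Y : R -> join A,
      bounded_lipschitz Y /\ forall s t, Y s t = X (r s (val t)).
  move=> [M XM] [lX0 lX1].
  have M0 : 0 <= M by apply: le_trans (anorm_ge0 _) (proj1 (XM 0 0)).
  have /choice[Y YE] : forall s, exists x : join A,
      forall t, x t = X (r s (val t)).
    move=> s; apply: join_mk; split.
    - apply: (@ncontinuous_lip _ _ _ (M * K)) => t t'.
      have [_ h] := XM (r s (val t)) (r s (val t')).
      by rewrite (le_trans h) // -mulrA ler_wpM2l.
    - exact: lX0.
    - exact: lX1.
  exists Y; split=> //; exists (M * (1 + `|L|)) => s s'.
  split; apply: jnorm_le => t.
    rewrite YE mulrDr mulr1 ler_wpDr ?mulr_ge0 //.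
    by have [] := XM 0 (r s' (val t)).
  rewrite joinDE joinNE !YE.
  have [_ h] := XM (r s (val t)) (r s' (val t)).
  rewrite (le_trans h) // -mulrA ler_wpM2l // (le_trans (rL _ _ _ _)) //.
    by have /set_mem := valP t; rewrite /= in_itv.
  rewrite ler_wpM2r // (le_trans (ler_norm _)) // lerDr //.
case: bW => bW bW' iW.
have [Y [bY YE]] := mk W bW lW; have [Y' [bY' YE']] := mk W' bW' lW'.
exists Y, Y'; split; last by move=> s t; rewrite YE YE'.
by split=> // s; split; apply/join_ext => t; rewrite joinME YE YE';
  case: (iW (r s (val t))).
Qed.

(** The segment of the right extension U of the unit of degree g grows from
[0, 1] to [0, 4], and that of the left extension V of the unit of degree h from
[0, 1] to [-3, 1]. After rescaling to [0, 1], U has become 1 on [1/2, 1]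
and V has become 1 on [0, 1/2], so that the commutator of the two is 1. *)
Lemma contractible_commutator g h :
  contractible A g -> contractible A h ->
  (exists p q : R -> H, contracting_path g p q /\ p 0 = pureT 1 g) ->
  contractible (join A) [~ g, h]%g.
Proof.
move=> [y [z yz]] [y' [z' yz']] [p [q [pq p0]]].
have [U [U' [bU lU lU' Ul Ur]]] := right_extension yz pq p0.
have [V [V' [bV lV lV' Vr Vl]]] := left_extension yz'.
have c0 := @clamp_ge0 R; have c1 := @clamp_le1 R.
have c4 s : `|1 + clamp s * 3| <= 4 :> R.
  by rewrite ger0_norm; have := c0 s; have := c1 s; lra.
have cl s s' t : 0 <= t <= 1 ->
    `|(1 + clamp s * 3) * t - (1 + clamp s' * 3) * t| <= 3 * `|s - s'| :> R.
  move=> /andP[t0 t1]; rewrite -mulrBl normrM (ger0_norm t0).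
  rewrite opprD addrACA subrr add0r -mulrBl normrM (@ger0_norm _ 3) //.
  have cs := clamp_lip s s'; have n0 := normr_ge0 (clamp s - clamp s').
  rewrite (@le_trans _ _ (`|clamp s - clamp s'| * 3)) //; last first.
    by rewrite mulrC ler_pM2l.
  by rewrite ler_piMr // mulr_ge0.
have cK s t t' :
    `|(1 + clamp s * 3) * t - (1 + clamp s * 3) * t'| <= 4 * `|t - t'| :> R.
  by rewrite -mulrBr normrM ler_wpM2r.
have r0 (s : R) : (1 + clamp s * 3) * 0 <= 0 by rewrite mulr0.
have r1 (s : R) : 1 <= (1 + clamp s * 3) * 1 by rewrite mulr1 lerDl mulr_ge0.
have [Y [Z [bYZ YE]]] := @join_path U U' (fun s t => (1 + clamp s * 3) * t)
  _ _ bU lU lU' r0 r1 cl cK.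
have cl' s s' t : 0 <= t <= 1 -> `|1 - (1 + clamp s * 3) * (1 - t)
      - (1 - (1 + clamp s' * 3) * (1 - t))| <= 3 * `|s - s'| :> R.
  move=> t01; rewrite opprB addrC addrA subrK distrC; apply: cl; lra.
have cK' s t t' : `|1 - (1 + clamp s * 3) * (1 - t)
      - (1 - (1 + clamp s * 3) * (1 - t'))| <= 4 * `|t - t'| :> R.
  rewrite opprB addrC addrA subrK (le_trans (cK _ _ _)) //.
  by rewrite opprB addrC addrA subrK.
have r0' (s : R) : 1 - (1 + clamp s * 3) * (1 - 0) <= 0 by have := c0 s; lra.
have r1' (s : R) : 1 <= 1 - (1 + clamp s * 3) * (1 - 1) by lra.
have [Y' [Z' [bYZ' YE']]] := @join_path V V'
  (fun s t => 1 - (1 + clamp s * 3) * (1 - t)) _ _ bV lV lV' r0' r1' cl' cK'.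
have val01 (t : unitI R) : 0 <= val t <= 1.
  by have /set_mem := valP t; rewrite /= in_itv.
have hY : homogeneous g (Y 0).
  apply: (@homogeneous_join _ _ _ _ _ (y \o val)) => t.
  rewrite (proj1 (YE _ _)) clamp_low // mul0r addr0 mul1r.
  by apply: Ul; case/andP: (val01 t).
have hY' : homogeneous h (Y' 0).
  apply: (@homogeneous_join _ _ _ _ _ (y' \o val)) => t.
  rewrite (proj1 (YE' _ _)) clamp_low // mul0r addr0 mul1r.
  by rewrite opprB addrC subrK; apply: Vr; case/andP: (val01 t).
have iYZ : forall s, inverses (Y s) (Z s) by case: bYZ.
have iYZ' : forall s, inverses (Y' s) (Z' s) by case: bYZ'.
have cst (s : R) : s <= 0 ->
    [/\ Y s = Y 0, Y' s = Y' 0, Z s = Z 0 & Z' s = Z' 0].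
  move=> s0; split; apply/join_ext => t.
  - by rewrite !(proj1 (YE _ _)) !clamp_low.
  - by rewrite !(proj1 (YE' _ _)) !clamp_low.
  - by rewrite !(proj2 (YE _ _)) !clamp_low.
  - by rewrite !(proj2 (YE' _ _)) !clamp_low.
have b := unit_pathM (unit_pathM (unit_pathC bYZ) (unit_pathC bYZ'))
                     (unit_pathM bYZ bYZ').
eexists; eexists; split; first exact: b.
- rewrite /= /commg /conjg mulgA; apply: homogeneousM.
    by apply: homogeneousM; [exact: homogeneousV hY|exact: homogeneousV hY'].
  exact: homogeneousM.
- by move=> s /cst[-> -> -> ->].
- move=> s s1 /=; apply/join_ext => t.
  have Ut : 2^-1 <= val t -> U ((1 + clamp s * 3) * val t) = 1.
    by move=> t1; rewrite clamp_high // Ur //; lra.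
  have Vt : val t <= 2^-1 -> V (1 - (1 + clamp s * 3) * (1 - val t)) = 1.
    by move=> t1; rewrite clamp_high // Vl //; lra.
  have [yz1 yz2] : inverses (Y s t) (Z s t).
    by case: (iYZ s) => /join_ext/(_ t) e1 /join_ext/(_ t) e2; split.
  have [yz3 yz4] : inverses (Y' s t) (Z' s t).
    by case: (iYZ' s) => /join_ext/(_ t) e1 /join_ext/(_ t) e2; split.
  rewrite !joinME join1E; have [t1|t1] := leP (val t) 2^-1.
    have Y1 : Y' s t = 1 by rewrite (proj1 (YE' _ _)) Vt.
    have Z1 : Z' s t = 1 by rewrite -yz3 Y1 mul1r.
    by rewrite Y1 Z1 !mulr1.
  have Y1 : Y s t = 1 by rewrite (proj1 (YE _ _)) Ut // ltW.
  have Z1 : Z s t = 1 by rewrite -yz1 Y1 mul1r.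
  by rewrite Y1 Z1 !mul1r.
Qed.

(** The contractible degrees of the join form a subgroup that contains all
commutators. *)
Lemma contractible_perfect :
  [~: [set: G]%SET, [set: G]%SET]%g = [set: G]%SET ->
  (forall g, contractible A g) ->
  (forall g, exists p q : R -> H, contracting_path g p q /\ p 0 = pureT 1 g) ->
  forall g, contractible (join A) g.
Proof.
move=> perfect hA hH.
pose S := [set g : G | `[< contractible (join A) g >]]%SET.
have inS g : g \in S <-> contractible (join A) g.
  by rewrite inE; split=> /asboolP.
have gS : group_set S.
  apply/group_setP; split=> [|g h]; first exact/inS/contractible1.
  by move=> /inS hg /inS hh; apply/inS/contractibleM.
have sub : [~: [set: G]%SET, [set: G]%SET]%g \subset Group gS.
  rewrite gen_subG; apply/fintype.subsetP => _ /imset2P[g h _ _ ->].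
  exact/inS/contractible_commutator.
move=> g; apply/inS; have /fintype.subsetP := sub; apply; rewrite perfect.
exact: finset.in_setT.
Qed.

End CommutatorContraction.

(** * Contracting the elements of a finite group in its group algebra *)

Section Base.
Variable R : realType.

(** X^N - 1 splits over the algebraically closed field R[i] and is separable, so
it has N distinct roots; a finite group of roots of unity is cyclic. *)
Lemma prim_root_exists (N : nat) :
  (0 < N)%N -> exists z : R[i], N.-primitive_root z.
Proof.
move=> N0; have N0' : N%:R != 0 :> R[i] by rewrite pnatr_eq0 -lt0n.
have [rs] := closed_field_poly_normal ('X^N - 1 : {poly R[i]}).
rewrite (monicP _) ?monicXnsubC // scale1r => rsE.
have [||| z _ zN] := hasP (@has_prim_root _ N rs N0 _ _ _); last by exists z.
- by apply/allP => z; rewrite -root_prod_XsubC -rsE.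
- by rewrite -separable_prod_XsubC -rsE separable_Xn_sub_1.
- by rewrite -ltnS -(size_prod_XsubC rs id) -rsE size_XnsubC.
Qed.

Lemma Re_le_normc (z : R[i]) : complex.Re z <= normc z.
Proof.
case: z => a b /=; rewrite (le_trans (ler_norm a)) // -sqrtr_sqr ler_wsqrtr //.
by rewrite lerDl sqr_ge0.
Qed.

Lemma normc_real (a : R) : normc a%:C = `|a|.
Proof. by rewrite /= expr0n addr0 sqrtr_sqr. Qed.

Lemma bounded_lipschitz_inv (f : R -> R[i]^o) (d : R) :
  0 < d -> (forall t, d <= normc (f t)) -> bounded_lipschitz f ->
  bounded_lipschitz (fun t => (f t)^-1 : R[i]^o).
Proof.
move=> d0 fd [K fK].
have K0 : 0 <= K by apply: le_trans (anorm_ge0 _) (proj1 (fK 0 0)).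
have f0 t : f t != 0.
  by apply: contraTneq (fd t) => ->; rewrite normc0 -ltNge.
have fi t : normc (f t)^-1 <= d^-1.
  by rewrite normcV lef_pV2 ?posrE // (lt_le_trans d0).
have d0' : 0 <= d^-1 by rewrite invr_ge0 ltW.
exists (d^-1 + d^-1 * d^-1 * K) => s t; split.
  by rewrite ler_wpDr ?mulr_ge0 //; apply: fi.
have -> : (f s)^-1 - (f t)^-1 = (f s)^-1 * (f t)^-1 * (- (f s - f t)) :> R[i].
  by field; rewrite !f0.
have [_ h] := fK s t.
rewrite /anorm /= !normcM normcN mulrDl ler_wpDl ?mulr_ge0 //.
rewrite -[X in _ <= X]mulrA ler_pM ?mulr_ge0 //;
  try exact: (anorm_ge0 (_ : R[i]^o)).
by rewrite ler_pM //; exact: (anorm_ge0 (_ : R[i]^o)).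
Qed.

(** Multiplying a fourth root by the powers of i rotates it by quarter turns,
and one of the four positions lies in the open right half-plane. *)
Lemma fourth_root (c : R[i]) :
  c != 0 -> exists u : R[i], u ^+ 4 = c /\ 0 < complex.Re u.
Proof.
move=> c0; pose w := sqrtc (sqrtc c).
have wE : w ^+ 4 = c by rewrite (exprM w 2 2) !sqr_sqrtc.
have i2 : 'i ^+ 2 = -1 :> R[i] by rewrite sqr_i.
have i4 : 'i ^+ 4 = 1 :> R[i] by rewrite (exprM _ 2 2) i2 sqrrN expr1n.
have [a0|a0|a0] := ltrgtP 0 (complex.Re w).
- by exists w.
- by exists (- w); rewrite exprNn -signr_odd mul1r raddfN /= oppr_gt0.
have [b0|b0|b0] := ltrgtP 0 (complex.Im w).
- exists (- (w * 'i)); rewrite exprNn -signr_odd mul1r exprMn i4 mulr1 wE.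
  by rewrite raddfN /= ReiNIm opprK.
- by exists (w * 'i); rewrite exprMn i4 mulr1 wE ReiNIm oppr_gt0.
case/eqP: c0; rewrite -wE.
have -> : w = 0 by apply/eqP; rewrite eq_complex -a0 -b0 !eqxx.
by rewrite expr0n.
Qed.

(** C^* is connected. The open right half-plane is convex and avoids 0, so the
segment from u to 1, where u is a fourth root of c there, stays away from 0;
its fourth power joins c to 1. *)
Lemma scalar_path (c : R[i]) : c != 0 -> exists y z : R -> R[i]^o,
  [/\ unit_path y z, forall t, t <= 0 -> y t = c & forall t, 1 <= t -> y t = 1].
Proof.
move=> /fourth_root[u [uE u0]].
pose w (t : R) : R[i]^o := (clamp t)%:C * (1 - u) + u.
have bw : bounded_lipschitz w.
  apply: bounded_lipschitzD; last exact: bounded_lipschitz_cst.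
  apply: bounded_lipschitzM; last exact: bounded_lipschitz_cst.
  have cn (a : R) : anorm (a%:C : R[i]^o) = `|a| by exact: normc_real.
  exists 1 => s t; split.
    by rewrite cn ger0_norm ?clamp_ge0 ?clamp_le1.
  have -> : (clamp s)%:C - (clamp t)%:C = (clamp s - clamp t)%:C :> R[i]^o.
    by rewrite rmorphB.
  by rewrite cn mul1r clamp_lip.
pose d := Num.min 1 (complex.Re u).
have d0 : 0 < d by rewrite lt_min ltr01.
have wd t : d <= normc (w t).
  have -> : d = clamp t * d + (1 - clamp t) * d.
    by rewrite -mulrDl addrC subrK mul1r.
  apply: le_trans (Re_le_normc _).
  have -> : complex.Re (w t) = clamp t * 1 + (1 - clamp t) * complex.Re u.
    by rewrite /w; case: (u) => a b /=; ring.
  rewrite lerD // ler_wpM2l ?clamp_ge0 ?subr_ge0 ?clamp_le1 //.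
    by rewrite ge_min lexx.
  by rewrite ge_min lexx orbT.
have w0 t : w t != 0.
  by apply: contraTneq (wd t) => ->; rewrite normc0 -ltNge.
have b1 : unit_path w (fun t => (w t)^-1).
  split=> //; first exact: bounded_lipschitz_inv d0 wd bw.
  by move=> t; split; [exact: mulfV|exact: mulVf].
have b2 := unit_pathM b1 b1; have b4 := unit_pathM b2 b2.
eexists; eexists; split; first exact: b4.
- move=> t t0; rewrite -uE /w clamp_low // mul0r add0r.
  by rewrite -!expr2 -exprM.
- by move=> t t1; rewrite /w clamp_high // mul1r subrK !mulr1.
Qed.

(** Orthogonality relations of the cyclic group of order N. *)
Lemma sum_prim_root (N : nat) (z : R[i]) (k l : nat) : N.-primitive_root z ->
  (k < N)%N -> (l < N)%N ->
  \sum_(j < N) (z ^+ k / z ^+ l) ^+ j = if k == l then N%:R else 0.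
Proof.
move=> zN kN lN.
have z0 : z != 0 by rewrite (prim_root_eq0 zN) -lt0n (leq_trans _ kN).
case: eqP => [->|/eqP kl].
  under eq_bigr => j _ do rewrite divff ?expf_neq0 // expr1n.
  by rewrite sumr_const card_ord.
apply/eqP; have : (z ^+ k / z ^+ l) ^+ N - 1 == 0.
  by rewrite exprMn exprVn -!exprM ![(_ * N)%N]mulnC !exprM
    !(prim_expr_order zN) !expr1n invr1 mulr1 subrr.
rewrite subrX1 mulf_eq0 => /orP[|//]; rewrite subr_eq0 => /eqP e.
have : z ^+ k == z ^+ l.
  by rewrite -[X in X == _](divfK (expf_neq0 l z0)) e mul1r.
by rewrite (eq_prim_root_expr zN) !modn_small // (negbTE kl).
Qed.

(** The algebra generated by x is a quotient of the split algebra
C[X] / (X^N - 1). The idempotents [e k] project onto the eigenspaces of x, so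
contracting each eigenvalue w^k to 1 by [scalar_path] contracts x to 1 in the
group of units. *)
Lemma finite_order_path (B : normedAlgType R) (x : B) (N : nat) :
  (0 < N)%N -> x ^+ N = 1 -> exists y z : R -> B,
  [/\ unit_path y z, forall t, t <= 0 -> y t = x & forall t, 1 <= t -> y t = 1].
Proof.
move=> N0 xN; have [w wN] := prim_root_exists N0.
have w0 : w != 0 by rewrite (prim_root_eq0 wN) -lt0n.
have N0' : N%:R != 0 :> R[i] by rewrite pnatr_eq0 -lt0n.
pose y (k : 'I_N) : B := (w ^+ k)^-1 *: x.
have yN k : y k ^+ N = 1.
  rewrite exprZn xN exprVn -exprM mulnC exprM (prim_expr_order wN).
  by rewrite expr1n invr1 scale1r.
pose e (k : 'I_N) : B := N%:R^-1 *: \sum_(j < N) y k ^+ j.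
have xe k : x * e k = w ^+ k *: e k.
  have ye : y k * e k = e k.
    apply/eqP; rewrite -subr_eq0 -[X in _ - X]mul1r -mulrBl -scalerAr.
    by rewrite -subrX1 yN subrr scaler0.
  by rewrite -[in RHS]ye /y -scalerAl scalerA mulfV ?scale1r ?expf_neq0.
have xje k j : x ^+ j * e k = (w ^+ k) ^+ j *: e k.
  elim: j => [|j IH]; first by rewrite !expr0 mul1r scale1r.
  by rewrite exprS -mulrA IH -scalerAr xe scalerA -exprSr.
have ee k l : e l * e k = if k == l then e k else 0.
  rewrite {1}/e -scalerAl mulr_suml.
  have -> : \sum_(j < N) y l ^+ j * e k =
      \sum_(j < N) (w ^+ k / w ^+ l) ^+ j *: e k.
    apply: eq_bigr => j _; rewrite exprZn -scalerAl xje scalerA; congr (_ *: _).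
    by rewrite mulrC -exprMn.
  rewrite -scaler_suml (sum_prim_root wN) // scalerA -val_eqE /=.
  by case: eqP; rewrite ?mulVf ?scale1r // mulr0 scale0r.
have e1 : \sum_k e k = 1.
  rewrite -scaler_sumr exchange_big /=.
  have -> : \sum_(j < N) \sum_(k < N) y k ^+ j =
      \sum_(j < N) (\sum_(k < N) (w ^+ 0 / w ^+ j) ^+ k) *: x ^+ j.
    apply: eq_bigr => j _; rewrite scaler_suml; apply: eq_bigr => k _.
    rewrite exprZn; congr (_ *: _).
    by rewrite mul1r !exprVn -!exprM mulnC.
  rewrite (bigD1 (Ordinal N0)) //= [X in _ + X]big1 ?addr0.
    by rewrite (@sum_prim_root N w 0 0 wN) // eqxx expr0 scalerA mulVf ?scale1r.
  move=> j j0; rewrite (sum_prim_root wN) // eq_sym.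
  by rewrite -val_eqE /= in j0; rewrite (negbTE j0) scale0r.
have ex : \sum_(k < N) w ^+ k *: e k = x.
  by under eq_bigr => k _ do rewrite -xe; rewrite -mulr_sumr e1 mulr1.
have /choice[c /choice[d cd]] := fun k : 'I_N => scalar_path (expf_neq0 k w0).
have bcd f : (forall k, bounded_lipschitz (f k : R -> R[i]^o)) ->
    bounded_lipschitz (fun t => \sum_k f k t *: e k).
  move=> bf; apply: bounded_lipschitz_sum => k.
  apply: (@bounded_lipschitz_map _ _ _ (fun a : R[i]^o => a *: e k)
    (anorm (e k))) (bf k).
    by move=> a b; rewrite scalerBl.
  by move=> a; rewrite anormZ mulrC.
have mult (a b : 'I_N -> R[i]) : (forall k, a k * b k = 1) ->
    (\sum_k a k *: e k) * (\sum_k b k *: e k) = 1.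
  move=> ab; rewrite -e1 mulr_suml; apply: eq_bigr => k _.
  rewrite mulr_sumr (bigD1 k) //= big1 ?addr0.
    by rewrite -scalerAl -scalerAr ee eqxx scalerA ab scale1r.
  move=> l lk; rewrite -scalerAl -scalerAr ee (negbTE lk).
  by rewrite !scaler0.
exists (fun t => \sum_k c k t *: e k), (fun t => \sum_k d k t *: e k); split.
- split.
  + by apply: bcd => k; have [[]] := cd k.
  + by apply: bcd => k; have [[]] := cd k.
  + by move=> t; split; apply: mult => k; have [[_ _ /(_ t)[]]] := cd k.
- move=> t t0; rewrite -[RHS]ex; apply: eq_bigr => k _.
  by have [_ -> //] := cd k.
- move=> t t1; rewrite -[RHS]e1; apply: eq_bigr => k _.
  by have [_ _ -> //] := cd k; rewrite scale1r.
Qed.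

Lemma group_path (G : finGroupType) (g : G) : exists p q : R -> groupAlg R G,
  contracting_path g p q /\ p 0 = pureT 1 g.
Proof.
have gX n : (pureT 1 g : groupAlg R G) ^+ n = pureT 1 (g ^+ n)%g.
  elim: n => [|n IH]; first by rewrite expr0 expg0.
  by rewrite exprS IH [LHS](@pureTM R G R[i]^o) mulr1 expgS.
have gN : (pureT 1 g : groupAlg R G) ^+ #[g]%g = 1 by rewrite gX expg_order.
have [p [q [pq p0 p1]]] := finite_order_path (order_gt0 g) gN.
exists p, q; rewrite p0 //; split=> //; split=> //.
- rewrite p0 //; apply/tensP => h; rewrite coact_pureT [RHS]tensE.
  by case: eqP.
- by move=> t t0; rewrite !p0.
Qed.

End Base.

(** * Continuous paths of complex numbers *)

Section Winding.
Variable R : realType.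
Local Notation C := (R[i]^o).
Local Notation I := (unitI R).

(** Connectedness of [0, 1]: the indicator function of P is continuous, so by
the intermediate value theorem it cannot take both values 0 and 1. *)
Lemma locally_constant_unitI (P : I -> Prop) :
  (forall t, \forall s \near t, P s <-> P t) -> P (unitI1 R) -> P (unitI0 R).
Proof.
move=> hP P1; apply: contrapT => P0.
pose f (t : I) : R := if `[< P t >] then 1 else 0.
have cf : continuous f.
  move=> t; apply: (@near_cst_continuous _ _ (f t)).
  apply: filterS (hP t) => s Pst; rewrite /f.
  by case: asboolP => h; case: asboolP => h' //; exfalso; tauto.
move: cf => /(@subspace_valL_continuousP' R [set` `[0%R, 1%R]] R 0) cf.
have fE (t : I) : valL_ 0 f (val t) = f t.
  by have /(congr1 (@^~ t)) := valLK 0 f.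
have [|c c01] := @IVT R (valL_ 0 f) 0 1 (2^-1) ler01 cf.
  rewrite (fE (unitI0 R)) (fE (unitI1 R)) /f (asboolT P1) (asboolF P0).
  by rewrite minEle maxEle ler01; lra.
have cI : c \in ([set` `[0%R, 1%R]] : set R) by rewrite inE.
rewrite (fE (exist _ c cI)) /f; case: asboolP => _; lra.
Qed.

Lemma normc_le_sum (z : R[i]) : normc z <= `|complex.Re z| + `|complex.Im z|.
Proof.
have -> : z = (complex.Re z)%:C + (complex.Im z)%:C * 'i.
  by case: z => a b; simpc.
rewrite (le_trans (le_normcD _ _)) // normcM /= !expr0n /= !addr0 add0r.
by rewrite expr1n sqrtr1 mulr1 !sqrtr_sqr; simpc.
Qed.

Lemma ncontinuousC (f : I -> C) :
  ncontinuous f <->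
  continuous (@complex.Re R \o f) /\ continuous (@complex.Im R \o f).
Proof.
split=> [cf|[cr ci]].
  split=> t; apply/subr_cvg0/norm_cvg0P;
    apply: (@squeeze_cvgr _ (nbhs t) _ _ (cst 0) (fun s => anorm (f s - f t)));
    try exact: cvg_cst; try exact: cf; apply: nearW => s /=;
    rewrite normr_ge0 /= /anorm /=; case: (f s) => a b; case: (f t) => c d /=;
    rewrite -sqrtr_sqr ler_wsqrtr // ?lerDl ?lerDr sqr_ge0 //.
apply: (@ncontinuous_le _ _ _ (fun t s =>
    `|(@complex.Re R \o f) s - (@complex.Re R \o f) t| +
    `|(@complex.Im R \o f) s - (@complex.Im R \o f) t|)).
  move=> t s; rewrite (le_trans (normc_le_sum _)) //=.
  by case: (f s) => a b; case: (f t) => c d.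
move=> t; rewrite -[0]addr0; apply: cvgD.
  by apply/norm_cvg0P/subr_cvg0; exact: cr.
by apply/norm_cvg0P/subr_cvg0; exact: ci.
Qed.

Lemma ncontinuousV (f : I -> C) : (forall t, f t != 0) -> ncontinuous f ->
  ncontinuous (fun t => (f t)^-1 : C).
Proof.
move=> f0 /ncontinuousC[cr ci]; apply/ncontinuousC.
have n0 t : complex.Re (f t) ^+ 2 + complex.Im (f t) ^+ 2 != 0.
  have := f0 t; case: (f t) => a b; rewrite eq_complex /= negb_and => ab.
  rewrite paddr_eq0 ?sqr_ge0 // !sqrf_eq0 negb_and.
  exact: ab.
pose n t := complex.Re (f t) * complex.Re (f t) +
            complex.Im (f t) * complex.Im (f t).
have cn : continuous n.
  by move=> t; apply: cvgD; apply: cvgM; (exact: cr || exact: ci).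
have cnV : continuous (fun t => (n t)^-1).
  by move=> t; apply: cvgV; [rewrite /n -!expr2|exact: cn].
split.
  have -> : @complex.Re R \o (fun t => (f t)^-1 : C) =
      fun t => complex.Re (f t) * (n t)^-1.
    by apply/funext => t; rewrite /n /=; case: (f t) => a b; rewrite -!expr2.
  by move=> t; apply: cvgM; [exact: cr|exact: cnV].
have -> : @complex.Im R \o (fun t => (f t)^-1 : C) =
    fun t => - (complex.Im (f t) * (n t)^-1).
  by apply/funext => t; rewrite /n /=; case: (f t) => a b; rewrite -!expr2.
by move=> t; apply: cvgN; apply: cvgM; [exact: ci|exact: cnV].
Qed.

Definition exp_complex (a b : R) : R[i] :=
  (expR a * cos b) +i* (expR a * sin b).

Lemma exp_complexD a b a' b' :
  exp_complex a b * exp_complex a' b' = exp_complex (a + a') (b + b').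
Proof.
by rewrite /exp_complex; simpc; rewrite expRD cosD sinD; congr (_ +i* _); ring.
Qed.

Lemma exp_complexX a b n : exp_complex a b ^+ n = exp_complex (a *+ n) (b *+ n).
Proof.
elim: n => [|n IH]; first by rewrite /exp_complex expR0 cos0 sin0 mulr1 mulr0.
by rewrite exprS IH exp_complexD !mulrS.
Qed.

(** The branch of z^(1/N) on the right half-plane. With b the argument of z, the
modulus of z is Re z / cos b. *)
Definition principal_root (N : nat) (z : R[i]) : R[i] :=
  let b := atan (complex.Im z / complex.Re z) in
  exp_complex (ln (complex.Re z / cos b) / N%:R) (b / N%:R).

Lemma cos_atan_gt0 (x : R) : 0 < cos (atan x).
Proof. by rewrite cos_atan invr_gt0 sqrtr_gt0 ltr_pwDl // sqr_ge0. Qed.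

Lemma principal_rootX N z :
  (0 < N)%N -> 0 < complex.Re z -> principal_root N z ^+ N = z.
Proof.
move=> N0 z0; have N0' : N%:R != 0 :> R by rewrite pnatr_eq0 -lt0n.
rewrite /principal_root exp_complexX -!(mulr_natr (_ / _)) !divfK //.
case: z z0 => a b /= a0; have c0 := cos_atan_gt0 (b / a).
rewrite /exp_complex lnK ?posrE ?divr_gt0 // divfK ?gt_eqF //.
have sin_atan (x : R) : sin (atan x) = x * cos (atan x).
  by rewrite -{2}(atanK x) /tan divfK // gt_eqF // cos_atan_gt0.
rewrite sin_atan.
by rewrite mulrCA divfK ?gt_eqF // divfK ?gt_eqF.
Qed.

Lemma ncontinuous_principal_root N (f : I -> C) :
  (forall t, 0 < complex.Re (f t)) -> ncontinuous f ->
  ncontinuous (fun t => principal_root N (f t) : C).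
Proof.
move=> f0 /ncontinuousC[cr ci]; apply/ncontinuousC.
pose b t := atan (complex.Im (f t) / complex.Re (f t)).
have cb : continuous b.
  move=> t; apply: (@continuous_comp _ _ _
    (fun t => complex.Im (f t) / complex.Re (f t)) atan).
    by apply: cvgM; [exact: ci|apply: cvgV; [rewrite gt_eqF|exact: cr]].
  exact: continuous_atan.
pose a t := ln (complex.Re (f t) / cos (b t)).
have cc : continuous (fun t => cos (b t)).
  move=> t; apply: (@continuous_comp _ _ _ b cos); first exact: cb.
  exact: continuous_cos.
have ca : continuous a.
  move=> t; apply: (@continuous_comp _ _ _
    (fun t => complex.Re (f t) / cos (b t)) (@ln R)).
    apply: cvgM; first exact: cr.
    by apply: cvgV; [rewrite gt_eqF // cos_atan_gt0|exact: cc].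
  by apply: continuous_ln; rewrite divr_gt0 // cos_atan_gt0.
have cbN : continuous (fun t => b t / N%:R).
  by move=> t; apply: cvgM; [exact: cb|exact: cvg_cst].
have ce : continuous (fun t => expR (a t / N%:R)).
  move=> t; apply: (@continuous_comp _ _ _ (fun t => a t / N%:R) (@expR R)).
    by apply: cvgM; [exact: ca|exact: cvg_cst].
  exact: continuous_expR.
split=> t; apply: cvgM; try exact: ce.
  by apply: (@continuous_comp _ _ _ (fun t => b t / N%:R) (@cos R));
    [exact: cbN|exact: continuous_cos].
by apply: (@continuous_comp _ _ _ (fun t => b t / N%:R) (@sin R));
    [exact: cbN|exact: continuous_sin].
Qed.

Lemma ncontinuous_prod (f : nat -> I -> C) n : (forall i, ncontinuous (f i)) ->
  ncontinuous (fun t => \prod_(i < n) f i t : C).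
Proof.
move=> cf; elim: n => [|n IH].
  have -> : (fun t => \prod_(i < 0) f i t : C) = fun=> 1.
    by apply/funext => t; rewrite big_ord0.
  exact: ncontinuous_cst.
have -> : (fun t => \prod_(i < n.+1) f i t : C) =
    fun t => (\prod_(i < n) f i t : C) * f n t.
  by apply/funext => t; rewrite big_ord_recr.
exact: ncontinuousM.
Qed.

Lemma ncontinuousX (f : I -> C) n :
  ncontinuous f -> ncontinuous (fun t => f t ^+ n : C).
Proof.
move=> cf; have := @ncontinuous_prod (fun=> f) n (fun=> cf).
by congr ncontinuous; apply/funext => t; rewrite prodr_const card_ord.
Qed.

Lemma ncontinuous_sum (f : nat -> I -> C) n : (forall i, ncontinuous (f i)) ->
  ncontinuous (fun t => \sum_(i < n) f i t : C).
Proof.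
move=> cf; elim: n => [|n IH].
  have -> : (fun t => \sum_(i < 0) f i t : C) = fun=> 0.
    by apply/funext => t; rewrite big_ord0.
  exact: ncontinuous_cst.
have -> : (fun t => \sum_(i < n.+1) f i t : C) =
    fun t => 1 *: (\sum_(i < n) f i t : C) + f n t.
  by apply/funext => t; rewrite big_ord_recr scale1r.
exact: ncontinuous_lin.
Qed.

Lemma ncontinuous_neq0 (f : I -> C) t : ncontinuous f -> f t != 0 ->
  \forall s \near t, f s != 0.
Proof.
move=> cf ft; have n0 : 0 < anorm (f t).
  rewrite lt_neqAle anorm_ge0 andbT eq_sym; apply: contra ft => /eqP h.
  by apply/eqP/anorm_eq0.
have := cf t => /cvgr_lt /(_ _ n0); apply: filterS => s.
apply: contraTneq => ->; rewrite sub0r anormN -leNgt //.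
Qed.

(** The N-th roots of unity form a discrete set. Near t,
f s ^ N - f t ^ N = (f s - f t) * g s where g s tends to N * f t ^ (N - 1),
which is not 0; so f is locally constant. *)
Lemma unity_root_path N (f : I -> C) : (0 < N)%N -> ncontinuous f ->
  (forall t, f t ^+ N = 1) -> f (unitI0 R) = f (unitI1 R).
Proof.
move=> N0 cf fN.
apply: (@locally_constant_unitI (fun t => f t = f (unitI1 R))) => // t.
pose g s : C := \sum_(i < N) f s ^+ (N.-1 - i) * f t ^+ i.
have f0 : f t != 0.
  apply: contra_eq_neq (fN t) => ->; rewrite expr0n.
  by case: (N) N0 => // n _; rewrite eq_sym oner_eq0.
have cg : ncontinuous g.
  apply: (@ncontinuous_sum (fun i s => f s ^+ (N.-1 - i) * f t ^+ i)) => i.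
  by apply: ncontinuousM; [exact: ncontinuousX|exact: ncontinuous_cst].
have g0 : g t != 0.
  rewrite /g (eq_bigr (fun=> f t ^+ N.-1)) => [|i _].
    rewrite sumr_const card_ord -mulr_natr mulf_neq0 ?expf_neq0 //.
    by rewrite pnatr_eq0 -lt0n.
  by rewrite -exprD subnK //; case: (N) N0 i => // n _ i; rewrite -ltnS.
apply: filterS (ncontinuous_neq0 cg g0) => s gs.
suff -> : f s = f t by [].
apply/eqP; rewrite -subr_eq0; have : (f s - f t) * g s = 0.
  by rewrite /g -subrXX !fN subrr.
by move/eqP; rewrite mulf_eq0 (negbTE gs) orbF.
Qed.

End Winding.

(** * The winding number obstruction *)

Section Obstruction.
Variable R : realType.
Local Notation C := (R[i]^o).
Local Notation I := (unitI R).

(** The quotient [l j s] in the proof is a loop based at 1. Having a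
continuous N-th root that is also a loop based at 1 is unchanged under
small perturbations of s, because the perturbation ratios stay in the right
half-plane, where [principal_root] is continuous; the end conditions on u
make the roots of these ratios cancel at t = 0 and t = 1. By connectedness the
property passes from s = 1, where the loop is constant, to s = 0. *)
Lemma winding_obstruction (N : nat) (u : nat -> nat -> I -> I -> C) (xi : C) :
  (0 < N)%N ->
  (forall j k s, ncontinuous (u j k s)) ->
  (forall j k s t, u j k s t != 0) ->
  (forall j k s, \forall s' \near s,
     forall t, 0 < complex.Re (u j k s' t / u j k s t)) ->
  (forall j k j' k' s, (j + k = j' + k')%N ->
     u j k s (unitI0 R) = u j' k' s (unitI0 R)) ->
  (forall j j' k s, u j k s (unitI1 R) = u j' k s (unitI1 R)) ->
  (forall j k j' k' t, u j k (unitI1 R) t = u j' k' (unitI1 R) t) ->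
  (forall j k t, u j k (unitI0 R) t = xi ^+ k * u j 0%N (unitI0 R) t) ->
  (forall t, u N 0%N (unitI0 R) t = u 0%N 0%N (unitI0 R) t) ->
  xi = 1.
Proof.
move=> N0 uc un unear u0 u1 uend ustart uN.
pose l j s t : C :=
  (u j.+2 0%N s t * u j 1%N s t) / (u j.+1 0%N s t * u j.+1 1%N s t).
pose D j s := exists mu : I -> C, [/\ ncontinuous mu, mu (unitI0 R) = 1,
  mu (unitI1 R) = 1, forall t, mu t != 0 & forall t, mu t ^+ N = l j s t].
pose close s' s j k := forall t, 0 < complex.Re (u j k s' t / u j k s t).
have stepD j s s' : close s' s j.+2 0%N -> close s' s j 1%N ->
    close s' s j.+1 0%N -> close s' s j.+1 1%N -> D j s' <-> D j s.
  move=> p1 p2 p3 p4.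
  pose a j k t : C := principal_root N (u j k s' t / u j k s t).
  pose rho t : C := (a j.+2 0%N t * a j 1%N t) / (a j.+1 0%N t * a j.+1 1%N t).
  have aN j' k : close s' s j' k ->
      forall t, a j' k t ^+ N = u j' k s' t / u j' k s t.
    by move=> h t; rewrite principal_rootX.
  have ac j' k : close s' s j' k -> ncontinuous (a j' k).
    move=> h; apply: ncontinuous_principal_root => //.
    by apply: ncontinuousM; [exact: uc|apply: ncontinuousV => //; exact: uc].
  have an j' k : close s' s j' k -> forall t, a j' k t != 0.
    move=> h t; apply: contra_eq_neq (aN _ _ h t) => ->.
    by rewrite expr0n gtn_eqF // eq_sym mulf_neq0 ?invr_eq0.
  have rn t : rho t != 0.
    rewrite /rho !(mulf_neq0, invr_eq0) //; try exact: an.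
  have rc : ncontinuous rho.
    apply: ncontinuousM; first by apply: ncontinuousM; exact: ac.
    apply: ncontinuousV; last by apply: ncontinuousM; exact: ac.
    by move=> t; apply: mulf_neq0; exact: an.
  have rN t : rho t ^+ N * l j s t = l j s' t.
    rewrite /rho !(exprMn, exprVn) !aN // /l.
    by field; rewrite !un.
  have r0 : rho (unitI0 R) = 1.
    have e1 : a j.+2 0%N (unitI0 R) = a j.+1 1%N (unitI0 R).
      by rewrite /a !(u0 j.+2 0%N j.+1 1%N) // addn0 addn1.
    have e2 : a j 1%N (unitI0 R) = a j.+1 0%N (unitI0 R).
      by rewrite /a !(u0 j 1%N j.+1 0%N) // addn0 addn1.
    by rewrite /rho e1 e2 [X in X / _]mulrC divff // mulf_neq0 //; exact: an.
  have r1 : rho (unitI1 R) = 1.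
    have e1 : a j.+2 0%N (unitI1 R) = a j.+1 0%N (unitI1 R).
      by rewrite /a !(u1 j.+2 j.+1).
    have e2 : a j 1%N (unitI1 R) = a j.+1 1%N (unitI1 R).
      by rewrite /a !(u1 j j.+1).
    by rewrite /rho e1 e2 divff // mulf_neq0 //; exact: an.
  split=> -[mu [mc m0 m1 mn mN]].
    exists (fun t => mu t / rho t); split.
    - by apply: ncontinuousM => //; apply: ncontinuousV.
    - by rewrite m0 r0 divr1.
    - by rewrite m1 r1 divr1.
    - by move=> t; rewrite mulf_neq0 ?invr_eq0.
    - move=> t; rewrite exprMn exprVn mN -rN mulrC mulKf //.
      by rewrite expf_neq0.
  exists (fun t => mu t * rho t); split.
  - exact: ncontinuousM.
  - by rewrite m0 r0 mulr1.
  - by rewrite m1 r1 mulr1.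
  - by move=> t; rewrite mulf_neq0.
  - by move=> t; rewrite exprMn mN mulrC rN.
have D0 j : D j (unitI0 R).
  apply: locally_constant_unitI => [s|].
    by near=> s'; apply: stepD; near: s'; exact: unear.
  exists (fun=> 1); split=> //; first exact: ncontinuous_cst.
    by move=> t; exact: oner_neq0.
  move=> t; rewrite expr1n /l !(uend j.+1 _ j.+2 0%N) !(uend j 1%N j.+2 0%N).
  by rewrite divff // mulf_neq0.
(* From here on only s = 0 matters; the factors xi ^+ k cancel in l j. *)
pose q j t := u j 0%N (unitI0 R) t.
have /choice[mu muP] := D0.
have muc i : ncontinuous (mu i) by case: (muP i).
pose r j t := q j.+1 t / q j t.
have qn j t : q j t != 0 by exact: un.
have xi0 : xi != 0.
  have := un 0%N 1%N (unitI0 R) (unitI0 R); rewrite ustart expr1.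
  by rewrite mulf_eq0 negb_or => /andP[].
have rS j t : r j.+1 t = mu j t ^+ N * r j t.
  have [_ _ _ _ ->] := muP j.
  rewrite /l (ustart j) (ustart j.+1 1%N) /r /q expr1.
  by field; rewrite !un.
pose M j t : C := \prod_(i < j) mu i t.
have rE j t : r j t = M j t ^+ N * r 0%N t.
  elim: j => [|j IH]; first by rewrite /M big_ord0 expr1n mul1r.
  by rewrite rS IH /M big_ord_recr /= exprMn mulrA (mulrC (mu j t ^+ N)).
have qE n t : \prod_(j < n) r j t = q n t / q 0%N t.
  elim: n => [|n IH]; first by rewrite big_ord0 divff.
  by rewrite big_ord_recr /= IH /r mulrC mulrA divfK.
(* Since q N = q 0, the product of the r j telescopes to 1. Substituting [rE],
   it is also the N-th power of th. *)
pose th t : C := r 0%N t * \prod_(j < N) M j t.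
have thN t : th t ^+ N = 1.
  have := qE N t; rewrite /q uN divff // => <-.
  under eq_bigr => j _ do rewrite rE.
  by rewrite big_split /= prodr_const card_ord prodrXl exprMn mulrC.
have Mc j : ncontinuous (M j) by exact: ncontinuous_prod.
have thc : ncontinuous th.
  apply: ncontinuousM; last exact: ncontinuous_prod.
  by apply: ncontinuousM; [exact: uc|apply: ncontinuousV => //; exact: uc].
have := unity_root_path N0 thc thN.
have M1 j : M j (unitI1 R) = 1.
  by rewrite /M big1 // => i _; case: (muP i).
have M0 j : M j (unitI0 R) = 1.
  by rewrite /M big1 // => i _; case: (muP i).
rewrite /th big1 // big1 // !mulr1 /r /q.
(* u_10 (0, 0) = u_01 (0, 0) = xi * u_00 (0, 0), so r 0 starts at xi. *)
rewrite (u0 1%N 0%N 0%N 1%N) // (ustart 0%N 1%N) expr1 mulfK //.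
by rewrite (u1 1%N 0%N) divff.
Unshelve. all: by end_near.
Qed.

End Obstruction.

(** * Linear characters on units of the second join *)

Section Necessity.
Variables (R : realType) (G : finGroupType).

(** The degree condition says that x t = y t (x) g for all t. Comparing the
coefficients at 1 in x z = 1 = z x gives the inverse w t of y t, which is the
coefficient of z t at g^-1. *)
Lemma homogeneous_unit_join (A : comodAlgType R G) (g : G) (x z : join A) :
  homogeneous g x -> inverses x z -> exists y w : unitI R -> A,
  [/\ ncontinuous y, forall t, inverses (y t) (w t),
      homogeneous g (y (unitI0 R)) & exists c : R[i], y (unitI1 R) = c *: 1].
Proof.
move=> hx [xz zx].
have xE t : x t = pureT (x t g) g.
  move/tensP/(_ g): hx; rewrite [RHS]tensE eqxx => /join_ext/(_ t).
  by rewrite join_coactE.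
exists (fun t => x t g), (fun t => z t g^-1%g); split=> //.
- apply: (@ncontinuous_le _ _ _ (fun t s => anorm (x s - x t))).
    by move=> t s; rewrite -tensNE -tensDE anorm_coef_le.
  exact: join_continuous.
- move=> t; split.
    have /join_ext/(_ t)/tensP/(_ 1%g) := xz.
    rewrite joinME xE tensME (bigD1 g) //= big1 ?addr0.
      by rewrite !tensE !eqxx mulg1.
    by move=> h hg; rewrite tensE (negbTE hg) mul0r.
  have /join_ext/(_ t)/tensP/(_ 1%g) := zx.
  rewrite joinME xE tensME (bigD1 g^-1%g) //= big1 ?addr0.
    by rewrite !tensE invgK mulg1 !eqxx.
  move=> h hg; rewrite tensE mulg1; case: eqP => [e|_]; last by rewrite mulr0.
  by rewrite -e invgK eqxx in hg.
- have [a xa] := join0P x.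
  have ag : a = x (unitI0 R) g.
    rewrite -(coact_counit (s:=A) (G:=G) a) -xa /idEps (bigD1 g) //=.
    rewrite big1 ?addr0 //.
    by move=> h hg; rewrite xE tensE (negbTE hg).
  by rewrite /homogeneous -{1}ag -xa -xE.
- by have [h xh] := join1P x; exists (h g); rewrite xh tensE.
Qed.

(** An element f of the join with f 0 = delta a is sent to a; this morphism from
the join to A is equivariant, so it preserves units of degree g. *)
Lemma cleft_join_base (A : comodAlgType R G) : cleft (join A) -> cleft A.
Proof.
move=> /cleftP cA; apply/cleftP => g; have [x [z [hx xz]]] := cA g.
have [y [w [_ yw y0 _]]] := homogeneous_unit_join hx xz.
by exists (y (unitI0 R)), (w (unitI0 R)).
Qed.

(** The map id (x) w from A (x) CG to A. *)
Definition char_eval (A : normedAlgType R) (w : G -> R[i]) (x : tensH A G) :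
  A := \sum_g w g *: x g.

Definition multiplicative_char (w : G -> R[i]) :=
  w 1%g = 1 /\ forall g h, w (g * h)%g = w g * w h.

Lemma char_evalB (A : normedAlgType R) w (x y : tensH A G) :
  char_eval w (x - y) = char_eval w x - char_eval w y.
Proof.
rewrite /char_eval -sumrB; apply: eq_bigr => g _.
by rewrite tensDE tensNE scalerBr.
Qed.

Lemma char_evalM (A : normedAlgType R) w (x y : tensH A G) :
  multiplicative_char w ->
  char_eval w (x * y) = char_eval w x * char_eval w y.
Proof.
move=> [_ wM]; rewrite /char_eval mulr_suml.
under eq_bigr => g _ do rewrite tensME scaler_sumr.
rewrite exchange_big /=; apply: eq_bigr => h _.
rewrite mulr_sumr (reindex_inj (mulgI h)) /=; apply: eq_bigr => g _.
by rewrite mulKg wM -scalerAl -scalerAr scalerA.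
Qed.

Lemma char_eval_pureT (A : normedAlgType R) w (a : A) (g : G) :
  char_eval w (pureT a g) = w g *: a.
Proof.
rewrite /char_eval (bigD1 g) //= big1 ?addr0; first by rewrite tensE eqxx.
by move=> h hg; rewrite tensE (negbTE hg) scaler0.
Qed.

Lemma char_evalZ (A : normedAlgType R) w (k : R[i]) (x : tensH A G) :
  char_eval w (k *: x) = k *: char_eval w x.
Proof.
rewrite /char_eval scaler_sumr; apply: eq_bigr => g _.
by rewrite tensZE !scalerA mulrC.
Qed.

Lemma char_eval1 (A : normedAlgType R) w :
  multiplicative_char w -> char_eval w (1 : tensH A G) = 1.
Proof.
move=> [w1 _]; rewrite -[1 in LHS]/(pureT 1 1%g).
by rewrite char_eval_pureT w1 scale1r.
Qed.

Lemma char_eval_norm (A : normedAlgType R) w (x : tensH A G) :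
  anorm (char_eval w x) <= (\sum_g normc (w g)) * anorm x.
Proof.
rewrite (le_trans (anorm_sum _)) // mulr_suml; apply: ler_sum => g _.
rewrite anormZ ler_wpM2l ?anorm_coef_le //.
exact: (anorm_ge0 (w g : R[i]^o)).
Qed.

Variable chi : G -> R[i].
Hypothesis chiP : multiplicative_char chi.
Variable N : nat.
Hypothesis N0 : (0 < N)%N.
Hypothesis chiN : forall g, chi g ^+ N = 1.
Let E1 := join (groupAlg R G).
Let chiX (j : nat) (g : G) := chi g ^+ j.

Let chiXP j : multiplicative_char (chiX j).
Proof.
case: chiP => c1 cM; split; rewrite /chiX; first by rewrite c1 expr1n.
by move=> g h; rewrite cM exprMn.
Qed.

(** The character chi^j (x) chi^k of CG (x) CG. *)
Let U (j k : nat) (x : tensH (groupAlg R G) G) : R[i]^o :=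
  @char_eval R[i]^o (chiX j) (char_eval (chiX k) x).

Let UB j k x y : U j k (x - y) = U j k x - U j k y.
Proof. by rewrite /U char_evalB; exact: (@char_evalB R[i]^o). Qed.
Let UM j k x y : U j k (x * y) = U j k x * U j k y.
Proof.
rewrite /U char_evalM; first exact: (@char_evalM R[i]^o _ _ _ (chiXP j)).
exact: chiXP.
Qed.
Let U1 j k : U j k 1 = 1.
Proof.
by rewrite /U char_eval1 //; exact: (@char_eval1 R[i]^o _ (chiXP j)).
Qed.
Let UZ j k c x : U j k (c *: x) = c * U j k x.
Proof. by rewrite /U char_evalZ; apply: (@char_evalZ R[i]^o). Qed.
Let Unorm j k : exists2 M, 0 <= M & forall x, normc (U j k x) <= M * anorm x.
Proof.
pose K l : R := \sum_g normc (chiX l g).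
have K0 l : 0 <= K l by apply: sumr_ge0 => g _; exact: (anorm_ge0 (_ : R[i]^o)).
exists (K j * K k) => [|x]; first exact: mulr_ge0.
rewrite -mulrA (le_trans (@char_eval_norm R[i]^o _ _)) // ler_wpM2l //.
  exact: K0.
exact: (@char_eval_norm (groupAlg R G)).
Qed.

(** chi^j (x) chi^k composed with Delta is chi^(j + k), as Delta g = g (x) g. *)
Let U_coact j k (a : groupAlg R G) :
  U j k (coact a) = @char_eval R[i]^o (chiX (j + k)) a.
Proof.
have evc g : char_eval (chiX k) (coact a) g = chiX k g * a g.
  rewrite [LHS](@tens_sumE R G R[i]^o) (bigD1 g) //= big1 ?addr0.
    by rewrite [LHS](@tensZE R G R[i]^o) !tensE eqxx.
  move=> h hg; rewrite [LHS](@tensZE R G R[i]^o) !tensE.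
  by rewrite eq_sym (negbTE hg) scaler0.
rewrite /U {1}/char_eval; apply: eq_bigr => g _.
by rewrite evc /chiX exprD -scalerA.
Qed.

Let U_oneT j j' k (h : groupAlg R G) : U j k (oneT _ h) = U j' k (oneT _ h).
Proof.
have -> : oneT (groupAlg R G) h = \sum_g h g *: pureT 1 g.
  apply/tensP => g; rewrite tens_sumE (bigD1 g) //= big1 ?addr0.
    by rewrite !ffunE eqxx.
  by move=> l lg; rewrite !ffunE eq_sym (negbTE lg) scaler0.
have U0 i : U i k 0 = 0 by rewrite -(subrr 0) UB subrr.
have Usum i : U i k (\sum_g h g *: pureT 1 g) = \sum_g h g * chiX k g.
  rewrite (big_morph (U i k) (id1 := 0) (op1 := +%R)).
  - apply: eq_bigr => g _; rewrite UZ /U char_eval_pureT (@char_evalZ R[i]^o).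
    by rewrite (@char_eval1 R[i]^o) // [_ *: _]mulr1.
  - move=> a b; have -> : a + b = a - (0 - b) by rewrite sub0r opprK.
    by rewrite UB (UB _ _ 0) U0 sub0r opprK.
  - exact: U0.
by rewrite !Usum.
Qed.

(** The path y of units of E_1 given by x satisfies the hypotheses of
[winding_obstruction] with u j k s t = (chi^j (x) chi^k) (y s t). Multiplying
y s' by the inverse w s of y s gives an element close to 1 uniformly in t, which
puts the ratios in the right half-plane. *)
Lemma char_trivial (g : G) (x z : join E1) :
  homogeneous g x -> inverses x z -> chi g = 1.
Proof.
move=> hx xz; have [y [w [yc yw y0 [c y1]]]] := homogeneous_unit_join hx xz.
have yw1 s t : y s t * w s t = 1.
  by have [/join_ext/(_ t)] := yw s.
pose u j k s t : R[i]^o := U j k (y s t).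
have uw j k s t : u j k s t * U j k (w s t) = 1 by rewrite /u -UM yw1 U1.
have un j k s t : u j k s t != 0.
  by apply: contra_eq_neq (uw j k s t) => ->; rewrite mul0r eq_sym oner_neq0.
have y0E t : y (unitI0 R) t = pureT (y (unitI0 R) t g) g.
  move/tensP/(_ g): y0; rewrite [RHS]tensE eqxx => /join_ext/(_ t).
  by rewrite join_coactE.
apply: (@winding_obstruction R N u (chi g) N0 _ un).
- move=> j k s; have [M M0 UM'] := Unorm j k.
  apply: (@ncontinuous_le _ _ _ (fun t t' => M * anorm (y s t' - y s t))).
    by move=> t t'; rewrite -UB; exact: UM'.
  move=> t; rewrite -(mulr0 M); apply: cvgM; first exact: cvg_cst.
  exact: join_continuous.
- move=> j k s; have [M M0 UM'] := Unorm j k.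
  have near1 : \forall s' \near s, M * (anorm (y s' - y s) * anorm (w s)) < 1.
    have lim : (fun s' => M * (anorm (y s' - y s) * anorm (w s))) @ s -->
        M * (0 * anorm (w s)).
      apply: cvgM; first exact: cvg_cst.
      by apply: cvgM; [exact: yc|exact: cvg_cst].
    by move/cvgr_lt: lim; apply; rewrite mul0r mulr0.
  apply: filterS near1 => s' lt1 t.
  have e : U j k ((y s' - y s) t * w s t) = u j k s' t * U j k (w s t) - 1.
    by rewrite joinDE joinNE mulrBl UB yw1 U1 UM.
  have -> : u j k s' t / u j k s t = 1 + U j k ((y s' - y s) t * w s t).
    rewrite e addrC subrK; congr (_ * _).
    by apply: (mulfI (un j k s t)); rewrite uw divff.
  have bd : normc (U j k ((y s' - y s) t * w s t)) < 1.
    apply: le_lt_trans lt1; apply: le_trans (UM' _) _; rewrite ler_wpM2l //.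
    apply: le_trans (anormM _ _) _.
    by apply: ler_pM; rewrite ?anorm_ge0 //; exact: le_jnorm.
  move: bd; set v := U j k _; move: (v) => a an.
  have := Re_le_normc (- a); rewrite normcN; move: (normc a) an => m m1.
  by case: a => a b /= am; lra.
- move=> j k j' k' s jk; have [a ya] := join0P (y s).
  by rewrite /u ya !U_coact jk.
- move=> j j' k s; have [h yh] := join1P (y s).
  by rewrite /u yh; exact: U_oneT.
- by move=> j k j' k' t; rewrite /u y1 joinZE join1E !UZ !U1.
- move=> j k t; rewrite /u y0E /U !char_eval_pureT !(@char_evalZ R[i]^o).
  by rewrite /chiX expr0 scale1r.
- move=> t; rewrite /u /U /char_eval /chiX; apply: eq_bigr => h _.
  by rewrite chiN expr0.
Qed.

End Necessity.

(** * Complex linear characters of a group that is not perfect *)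

Section Characters.
Variables (R : realType) (G : finGroupType).

(** The kernels of the linear characters with algebraic values intersect in the
commutator subgroup. Such a character takes its values in the N-th roots of
unity, N = #|G|; sending a primitive root of unity of [algC] to one of R[i]
turns it into a character with values in R[i]. *)
Lemma exists_char : [~: [set: G]%SET, [set: G]%SET]%g <> [set: G]%SET ->
  exists chi : G -> R[i], [/\ multiplicative_char chi,
    forall g, chi g ^+ #|G| = 1 & exists g, chi g <> 1].
Proof.
move=> nperf; set N := #|G|.
have N0 : (0 < N)%N by apply/card_gt0P; exists 1%g.
have [g gN] : exists g : G, g \notin [~: [set: G]%SET, [set: G]%SET]%g.
  apply: contrapT => /forallNP h; apply: nperf; apply/finset.setP => g.
  by rewrite finset.in_setT; have /negP := h g; rewrite negbK.
have [i lini gi] : exists2 i : Iirr [set: G]%G,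
    'chi_i \is a linear_char & g \notin cfker 'chi_i.
  apply: contrapT => nex; case/negP: gN.
  have /(congr1 (fun A : {set G} => g \in A)) := cap_cfker_lin_irr [set: G]%G.
  rewrite derg1 => <-; apply/finset.bigcapP => i lini.
  by apply: contrapT => /negP gi; apply: nex; exists i.
have inG (h : G) : h \in [set: G]%G by exact: finset.in_setT.
have [z zN] := C_prim_root_exists N0.
have [w wN] := prim_root_exists R N0.
have /choice[e eE] (h : G) : exists k : nat, 'chi_i h = z ^+ k.
  have hN : 'chi_i h ^+ N = 1.
    have /dvdnP[q qE] : (#[h]%g %| N)%N.
      by rewrite /N -cardsT; apply: (@order_dvdG _ [set: G]%G).
    by rewrite qE mulnC exprM (lin_char_unity_root lini) ?expr1n.
  by have [k ->] := prim_rootP zN hN; exists k.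
have ew h k : z ^+ h == z ^+ k = (w ^+ h == w ^+ k).
  by rewrite (eq_prim_root_expr zN) (eq_prim_root_expr wN).
exists (fun h => w ^+ e h); split.
- split=> [|h k].
    by apply/eqP; rewrite -(expr0 w) -ew -eE (lin_char1 lini).
  by apply/eqP; rewrite -exprD -ew exprD -!eE (lin_charM lini).
- by move=> h; rewrite -exprM mulnC exprM (prim_expr_order wN) expr1n.
exists g => /eqP; rewrite -(expr0 w) -ew -eE expr0 => /eqP g1.
by case/negP: gi; rewrite cfkerEirr inE g1 (lin_char1 lini).
Qed.

End Characters.

Local Close Scope classical_set_scope.
Unset Implicit Arguments.

Theorem theorem4p13 (R : realType) (Gamma : finGroupType) (n : nat)
    (hn : (2 <= n)%N) (hGamma : [set: Gamma] <> 1%g) :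
  cleft (iterated_join R Gamma n) <->
  [~: [set: Gamma], [set: Gamma]]%g = [set: Gamma].
Proof.
split=> [cn|perf].
  have c2 : cleft (iterated_join R Gamma 2).
    elim: n hn cn => [|[|[|n]] IH] // _ cn.
    by apply: IH => //; apply: cleft_join_base.
  apply: contrapT => /(exists_char R)[chi [chiP chiN [g]]]; apply.
  have [x [z [hx xz]]] := (cleftP _).1 c2 g.
  have N0 : (0 < #|Gamma|)%N by apply/card_gt0P; exists 1%g.
  exact: char_trivial chiP _ N0 chiN _ _ _ hx xz.
case: n hn => // n _; apply: cleft_join.
elim: n => [|n IH] g.
  by have [p [q [pq _]]] := @group_path R _ g; exists p, q.
by apply: contractible_perfect => // h; exact: group_path.
Qed.
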